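(* Let $(\alpha_n)$ be a Riemann sequence. There exists a real constant $B$ such that $$\sum_{n=1}^\infty\log\Bigl(1+\frac{z^2}{\alpha_n^2}\Bigr)\simeq\frac z2\log\frac{z}{2\pi}-\frac z2+\frac74\log z+B-\sum_{n=1}^\infty\frac{a_{n+1}}{n\,z^n}.$$
   Context: Asymptotic notation: for a function $f(z)$ defined on a half-plane $\operatorname{Re}z>a$, one writes $f(z)\simeq\sum_{n=0}^\infty\frac{b_n}{z^n}$ if for each natural number $N$ and any $0<\varepsilon<\frac{\pi}{2}$ we have $\lim_{z\to\infty}\bigl(f(z)-\sum_{n=0}^N\frac{b_n}{z^n}\bigr)z^N=0$ for $|\arg z|\le\frac{\pi}{2}-\varepsilon$; and $f\simeq g+\sum_n b_nz^{-n}$ means $f-g\simeq\sum_n b_nz^{-n}$. Coefficients: $a_{2n+1}=\frac{8-E_{2n}}{2^{2n+2}}$ ($n\ge0$), $a_{2n}=\bigl(1-\frac{1}{2^{2n-1}}\bigr)\frac{B_{2n}}{4n}$ ($n\ge1$), with $\frac{2e^t}{e^{2t}+1}=\sum_{n\ge0} E_n\frac{t^n}{n!}$, $\frac{t}{e^t-1}=\sum_{n\ge0} B_n\frac{t^n}{n!}$. Riemann sequence: a sequence of complex numbers $(\alpha_n)_{n\ge1}$ is a Riemann sequence if: (a) $1<\operatorname{Re}\alpha_1\le\operatorname{Re}\alpha_2\le\cdots$; (b) each complex number $\alpha$ has finite multiplicity $\nu(\alpha)=\operatorname{card}\{n:\alpha_n=\alpha\}$, and $\nu(\alpha)=\nu(\overline\alpha)$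 if $\alpha$ is not real; (c) there is a constant $C$ with $|\operatorname{Im}\alpha_n|<C$ for all $n$; (d) $|\arg\alpha_n|<\pi/4$, i.e. $|\operatorname{Im}\alpha_n|<\operatorname{Re}\alpha_n$, for all $n$; (e) $\sum_{k=1}^\infty\frac{2z}{z^2+\alpha_k^2}\simeq\frac12\log\frac{z}{2\pi}+\sum_{n=1}^\infty\frac{a_n}{z^n}$. Branches: $\log z$ and $\log\frac{z}{2\pi}$ are principal in the right half-plane. $1+z^2/\alpha_n^2$ has no zeros in the simply connected region $\{\operatorname{Re}z>C\}\cup\{|\operatorname{Im}z|<1\}$ (with $C>0$ as in (c)), and $\log(1+z^2/\alpha_n^2)$ is the analytic branch there that vanishes at $z=0$. *)

(* Defs.v *)
From Stdlib Require Import Reals Factorial List.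
From Coquelicot Require Import Coquelicot.
Open Scope R_scope.

(** Everything below uses Stdlib's real numbers and Coquelicot's [C]. *)

Definition Cexp (z : C) : C :=
  (exp (Re z) * cos (Im z), exp (Re z) * sin (Im z)).

(** The principal argument, with values in (-PI, PI]; the value at [0] is junk. *)
Definition Carg (z : C) : R :=
  let x := Re z in
  let y := Im z in
  if Rlt_dec 0 x then atan (y / x)
  else if Rlt_dec x 0 then
    (if Rle_dec 0 y then atan (y / x) + PI else atan (y / x) - PI)
  else if Rlt_dec 0 y then PI / 2
  else if Rlt_dec y 0 then - (PI / 2)
  else 0.

Definition Clog (z : C) : C := (ln (Cmod z), Carg z).

Definition C_infty (P : C -> Prop) : Prop :=
  exists M : R, forall z : C, M < Cmod z -> P z.

Global Instance C_infty_filter : Filter C_infty.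
Proof.
constructor.
- exists 0; easy.
- intros P Q [M HM] [N HN]; exists (Rmax M N); intros z Hz; split.
  + apply HM; apply Rle_lt_trans with (2 := Hz); apply Rmax_l.
  + apply HN; apply Rle_lt_trans with (2 := Hz); apply Rmax_r.
- intros P Q HPQ [M HM]; exists M; auto.
Qed.

Definition sector (eps : R) (z : C) : Prop := Rabs (Carg z) <= PI / 2 - eps.

(** [asymp f g b] is f(z) ~ g(z) + sum_{n >= 0} b_n / z^n. *)
Definition asymp (f g : C -> C) (b : nat -> C) : Prop :=
  forall (N : nat) (eps : R), 0 < eps < PI / 2 ->
    filterlim
      (fun z : C =>
         ((f z - g z - sum_n (fun n => b n / z ^ n) N) * z ^ N)%C)
      (within (sector eps) C_infty) (locally (RtoC 0)).

(** The asymptotic relation for the function z |-> sum_n u_n(z), the series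
    being convergent (so that the function is defined) on Re z > a. *)
Definition series_asymp
    (a : R) (u : nat -> C -> C) (g : C -> C) (b : nat -> C) : Prop :=
  exists S : C -> C,
    (forall z : C, a < Re z -> is_series (fun n => u n z) (S z)) /\
    asymp S g b.

(** Coefficients of an expansion sum_{n >= 1} c_n / z^n without constant term. *)
Definition from1 (c : nat -> R) (n : nat) : C :=
  match n with 0%nat => RtoC 0 | _ => RtoC (c n) end.

Definition euler_numbers (E : nat -> R) : Prop :=
  locally 0 (fun t : R =>
    is_pseries (fun n => E n / INR (fact n)) t
      (2 * exp t / (exp (2 * t) + 1))).

(** A punctured neighbourhood, since t / (exp t - 1) has a removable
    singularity at 0; its value 1 there is recovered by continuity. *)
Definition bernoulli_numbers (Bn : nat -> R) : Prop :=
  locally' 0 (fun t : R =>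
    is_pseries (fun n => Bn n / INR (fact n)) t (t / (exp t - 1))).

(** a_n for n >= 1, written with n = 2m+1 or n = 2m; a_0 is never used. *)
Definition stirling_coef (E Bn : nat -> R) (n : nat) : R :=
  let m := Nat.div2 n in
  if Nat.odd n
  then (8 - E (2 * m)%nat) / 2 ^ (2 * m + 2)
  else (1 - 1 / 2 ^ (2 * m - 1)) * (Bn (2 * m)%nat / (4 * INR m)).

Definition has_multiplicity (alpha : nat -> C) (w : C) (m : nat) : Prop :=
  exists l : list nat,
    NoDup l /\ length l = m /\ (forall n : nat, In n l <-> alpha n = w).

(** Sequences are indexed from 0: [alpha n] is the (n+1)-st term. *)
Record riemann_sequence (E Bn : nat -> R) (alpha : nat -> C) : Prop := {
  rs_first : 1 < Re (alpha 0%nat);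
  rs_mono : forall n : nat, Re (alpha n) <= Re (alpha (S n));
  rs_mult : forall w : C, exists m : nat, has_multiplicity alpha w m;
  rs_conj : forall (w : C) (m : nat), Im w <> 0 ->
    has_multiplicity alpha w m -> has_multiplicity alpha (Cconj w) m;
  rs_strip : exists M : R, forall n : nat, Rabs (Im (alpha n)) < M;
  rs_arg : forall n : nat, Rabs (Carg (alpha n)) < PI / 4;
  rs_asymp : exists a : R,
    series_asymp a
      (fun k z => (2 * z / (z ^ 2 + alpha k ^ 2))%C)
      (fun z => (/ 2 * Clog (z / (2 * PI)%R))%C)
      (from1 (stirling_coef E Bn))
}.

Definition log_region (M : R) (z : C) : Prop := M < Re z \/ Rabs (Im z) < 1.

(** [L] is the analytic branch of [log f] on the (open, simply connected)
    region [D] that vanishes at [0]. *)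
Definition is_log_branch (D : C -> Prop) (f L : C -> C) : Prop :=
  (forall z : C, D z ->
     ex_derive (K := C_AbsRing) (V := C_NormedModule) L z /\
     Cexp (L z) = f z) /\
  L (RtoC 0) = RtoC 0.

(* Main.v *)
(* Differentiating the logarithms term by term turns the claim into the
   integration of the expansion (e).  The absolute convergence needed for this
   comes from (e) itself: for [x] real and large the real part of
   [2x / (x^2 + alpha_k^2)] is at least a constant times [1 / (Re alpha_k)^2], so
   [sum_k (Re alpha_k)^(-2)] is finite.  The remainder of order [N + 1] in (e) is
   [o(|z|^(-N-1))]; integrated along the real axis to infinity it leaves a
   constant [B] and an error [o(x^(-N))], and a vertical segment leads from the
   real axis to any other point of a sector.  The sum is real on the positive
   axis, whence [B] is real, because the indices [k] with [Re alpha_k <= rho] form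
   a finite set stable under conjugation. *)
Require Import Defs.
From Stdlib Require Import Reals Lra Lia List Permutation Classical.
From Coquelicot Require Import Coquelicot.
Open Scope R_scope.

(** Integration is carried out as a comparison of derivatives: if [|f'| <= phi'] on a segment, the
    increment of [f] is at most that of [phi], and [phi] is an explicit primitive such as
    [-(eta/N) t^(-N)]. Only derivatives in one real parameter [s] along [p + s q] occur, and each
    passage from components to the modulus costs a harmless factor 2. The term [a_1/z] is the one
    without a power as primitive; it is matched by [7/4 log z], because [E_0 = 1] makes [a_1 = 7/4].
    For [N = 0] the primitive of the error would be a logarithm, so the orders [N >= 1] are treated
    directly and [N = 0] is deduced from [N = 1]. The summability of [(Re alpha_k)^(-2)] serves
    three times: it makes the logarithms summable, it majorizes the derivatives, and it forces
    [Re alpha_k] to increase strictly infinitely often, which yields the conjugation-stable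
    prefixes. That the sum is real is proved for the derivative, whose terms are explicit in
    [alpha_k], and carried to the logarithms from the origin. *)

(** * Mean value inequalities for series of real functions *)

Lemma mean_value_le (f df phi dphi : R -> R) (a b : R) :
  a <= b ->
  (forall t, a <= t <= b -> is_derive f t (df t)) ->
  (forall t, a <= t <= b -> is_derive phi t (dphi t)) ->
  (forall t, a <= t <= b -> Rabs (df t) <= dphi t) ->
  Rabs (f b - f a) <= phi b - phi a.
Proof.
intros Hab Hf Hp Hle.
assert (key : forall h dh : R -> R,
  (forall t, a <= t <= b -> is_derive h t (dh t)) ->
  (forall t, a <= t <= b -> 0 <= dh t) -> h a <= h b).
{ intros h dh Hh Hpos.
  destruct (MVT_gen h a b dh) as [c [Hc Heq]].
  - intros x Hx; rewrite Rmin_left, Rmax_right in Hx by easy; apply Hh; lra.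
  - intros x Hx; rewrite Rmin_left, Rmax_right in Hx by easy.
    apply derivable_continuous_pt; exists (dh x).
    apply is_derive_Reals, Hh; lra.
  - rewrite Rmin_left, Rmax_right in Hc by easy.
    assert (0 <= dh c * (b - a)) by (apply Rmult_le_pos; [apply Hpos; lra | lra]).
    lra. }
assert (H1 : phi a - f a <= phi b - f b).
{ apply (key (fun t => phi t - f t) (fun t => dphi t - df t)).
  - intros t Ht. apply (is_derive_minus phi f); auto.
  - intros t Ht. generalize (Hle t Ht) (Rle_abs (df t)); lra. }
assert (H2 : phi a + f a <= phi b + f b).
{ apply (key (fun t => phi t + f t) (fun t => dphi t + df t)).
  - intros t Ht. apply (is_derive_plus phi f); auto.
  - intros t Ht. generalize (Hle t Ht) (Rle_abs (- df t)).
    rewrite Rabs_Ropp; lra. }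
apply Rabs_le; lra.
Qed.

Lemma is_lim_seq_sum_n (v : nat -> R) (l : R) :
  is_series v l -> is_lim_seq (sum_n v) l.
Proof. easy. Qed.

(** Weierstrass test with an explicit remainder: between [n] and [m + n] the partial sums of [v]
    move no more than those of [c]; then [m] tends to infinity. The bound depends on [c] only, hence
    is uniform in any parameter of [v]. *)
Lemma tail_bound (v c : nat -> R) (l : R) (n : nat) :
  ex_series c -> (forall k, Rabs (v k) <= c k) -> is_series v l ->
  Rabs (l - sum_n v n) <= Series c - sum_n c n.
Proof.
intros Hc Hle Hv.
assert (Hm : forall m, Rabs (sum_n v (m + n) - sum_n v n)
                       <= sum_n c (m + n) - sum_n c n).
{ induction m as [|m IH]; simpl.
  - unfold Rminus; rewrite !Rplus_opp_r, Rabs_R0; lra.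
  - rewrite !sum_Sn; unfold plus; simpl.
    replace (sum_n v (m + n) + v (S (m + n)) - sum_n v n)
      with ((sum_n v (m + n) - sum_n v n) + v (S (m + n))) by ring.
    eapply Rle_trans; [apply Rabs_triang|].
    generalize (Hle (S (m + n))); lra. }
assert (Lv : is_lim_seq (fun m => sum_n v (m + n)) l)
  by apply (is_lim_seq_incr_n (sum_n v)), Hv.
assert (Lc : is_lim_seq (fun m => sum_n c (m + n)) (Series c))
  by apply (is_lim_seq_incr_n (sum_n c)), (Series_correct _ Hc).
apply (is_lim_seq_le _ _ (Rabs (l - sum_n v n)) (Series c - sum_n c n) Hm).
- apply (is_lim_seq_abs _ (l - sum_n v n)).
  apply (is_lim_seq_minus' _ _ _ _ Lv); apply is_lim_seq_const.
- apply (is_lim_seq_minus' _ _ _ _ Lc); apply is_lim_seq_const.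
Qed.

Lemma is_derive_sum_n_R (u v : nat -> R -> R) (t : R) (n : nat) :
  (forall k, is_derive (u k) t (v k t)) ->
  is_derive (fun s => sum_n (fun k => u k s) n) t (sum_n (fun k => v k t) n).
Proof.
intros H; apply (is_derive_sum_n (fun k s => u k s)); auto.
Qed.

(* The termwise derivatives are summed before the mean value inequality is
   applied, so that the sum of the series need not be differentiated. *)
Lemma series_mean_value (u v : nat -> R -> R) (c : nat -> R)
    (V g dg phi dphi : R -> R) (a b Ua Ub : R) :
  a <= b ->
  ex_series c ->
  (forall k t, a <= t <= b -> is_derive (u k) t (v k t)) ->
  (forall k t, a <= t <= b -> Rabs (v k t) <= c k) ->
  (forall t, a <= t <= b -> is_series (fun k => v k t) (V t)) ->
  (forall t, a <= t <= b -> is_derive g t (dg t)) ->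
  (forall t, a <= t <= b -> is_derive phi t (dphi t)) ->
  (forall t, a <= t <= b -> Rabs (V t - dg t) <= dphi t) ->
  is_series (fun k => u k a) Ua ->
  is_series (fun k => u k b) Ub ->
  Rabs ((Ub - g b) - (Ua - g a)) <= phi b - phi a.
Proof.
intros Hab Hc Hu Hv HV Hg Hphi Hle HUa HUb.
set (tl := fun n => Series c - sum_n c n).
(* The derivative of a partial sum differs from [V] by at most the tail [tl n]. This error is
   absorbed by the linear term [tl n * t], which disappears in the limit. *)
assert (Hn : forall n,
  Rabs ((sum_n (fun k => u k b) n - g b) - (sum_n (fun k => u k a) n - g a))
  <= (phi b + tl n * b) - (phi a + tl n * a)).
{ intros n.
  apply (mean_value_le (fun t => sum_n (fun k => u k t) n - g t)
           (fun t => sum_n (fun k => v k t) n - dg t)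
           (fun t => phi t + tl n * t) (fun t => dphi t + tl n)); auto.
  - intros t Ht.
    apply (is_derive_minus (fun t => sum_n (fun k => u k t) n) g); auto.
    apply is_derive_sum_n_R; auto.
  - intros t Ht.
    apply (is_derive_plus phi (fun t => tl n * t)); auto.
    auto_derive; [easy | ring].
  - intros t Ht.
    assert (Ht' := tail_bound (fun k => v k t) c (V t) n Hc
                     (fun k => Hv k t Ht) (HV t Ht)).
    replace (sum_n (fun k => v k t) n - dg t)
      with ((V t - dg t) + - (V t - sum_n (fun k => v k t) n)) by ring.
    eapply Rle_trans; [apply Rabs_triang|]; rewrite Rabs_Ropp.
    generalize (Hle t Ht); unfold tl; lra. }
assert (Ltl : is_lim_seq tl 0).
{ replace (Finite 0) with (Finite (Series c - Series c)) by (f_equal; ring).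
  apply is_lim_seq_minus'; [apply is_lim_seq_const|].
  apply (Series_correct _ Hc). }
enough (H : Rbar_le (Rabs ((Ub - g b) - (Ua - g a)))
                    ((phi b + 0 * b) - (phi a + 0 * a))) by (simpl in H; lra).
apply (is_lim_seq_le _ _ _ _ Hn).
- apply (is_lim_seq_abs _ (Finite ((Ub - g b) - (Ua - g a)))).
  apply is_lim_seq_minus'; (apply is_lim_seq_minus'; [|apply is_lim_seq_const]);
  assumption.
- apply is_lim_seq_minus'; (apply is_lim_seq_plus'; [apply is_lim_seq_const|]);
  apply is_lim_seq_mult'; auto using is_lim_seq_const.
Qed.

(** * Complex series by components *)

Lemma im_le_Cmod (z : C) : Rabs (Im z) <= Cmod z.
Proof. exact (Rle_trans _ _ _ (Rmax_r _ _) (Rmax_Cmod z)). Qed.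

Lemma Cmod_le_re_im (z : C) : Cmod z <= Rabs (Re z) + Rabs (Im z).
Proof.
replace z with (RtoC (Re z) + Ci * RtoC (Im z))%C at 1.
- eapply Rle_trans; [apply Cmod_triangle|].
  rewrite Cmod_mult, Cmod_Ci, !Cmod_R; lra.
- destruct z as [x y]; unfold Cplus, Cmult, Ci, RtoC; simpl; f_equal; ring.
Qed.

Lemma Re_sum_n (u : nat -> C) (n : nat) :
  Re (sum_n u n) = sum_n (fun k => Re (u k)) n.
Proof.
induction n as [|n IH]; [now rewrite !sum_O|].
rewrite !sum_Sn, <- IH; reflexivity.
Qed.

Lemma Im_sum_n (u : nat -> C) (n : nat) :
  Im (sum_n u n) = sum_n (fun k => Im (u k)) n.
Proof.
induction n as [|n IH]; [now rewrite !sum_O|].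
rewrite !sum_Sn, <- IH; reflexivity.
Qed.

Lemma is_seriesC (u : nat -> C) (l : C) :
  is_series (K := C_AbsRing) (V := C_NormedModule) u l <->
  is_series (fun k => Re (u k)) (Re l) /\ is_series (fun k => Im (u k)) (Im l).
Proof.
unfold is_series; split.
- intros H; split; apply filterlim_locally; intros eps;
  generalize (proj1 (filterlim_locally _ _) H eps);
  apply filter_imp; intros n Hn.
  + rewrite <- Re_sum_n; apply Hn.
  + rewrite <- Im_sum_n; apply Hn.
- intros [H1 H2]; apply filterlim_locally; intros eps.
  generalize (filter_and _ _ (proj1 (filterlim_locally _ _) H1 eps)
                (proj1 (filterlim_locally _ _) H2 eps)).
  apply filter_imp; intros n [K1 K2].
  rewrite <- Re_sum_n in K1; rewrite <- Im_sum_n in K2; now split.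
Qed.

Definition CSeries (u : nat -> C) : C :=
  (Series (fun k => Re (u k)), Series (fun k => Im (u k))).

Lemma CSeries_correct (u : nat -> C) (c : nat -> R) :
  ex_series c -> (forall k, Cmod (u k) <= c k) ->
  is_series (K := C_AbsRing) (V := C_NormedModule) u (CSeries u).
Proof.
intros Hc Hle; apply is_seriesC; split;
apply Series_correct, (ex_series_le (V := R_CompleteNormedModule) _ c); auto;
intros k; (eapply Rle_trans; [|apply Hle]).
- apply re_le_Cmod.
- apply im_le_Cmod.
Qed.

(** * Derivatives of complex functions of a real variable *)

(** Taken componentwise so that the real mean value inequality applies to each part. Complex
    derivatives enter only through [is_derive_path]. *)
Definition cder (f : R -> C) (t : R) (l : C) : Prop :=
  is_derive (fun s => Re (f s)) t (Re l) /\
  is_derive (fun s => Im (f s)) t (Im l).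

Lemma cder_ext (f g : R -> C) (t : R) (l : C) :
  (forall s, f s = g s) -> cder f t l -> cder g t l.
Proof.
intros H [H1 H2]; split.
- apply (is_derive_ext (fun s => Re (f s))); [intros s; now rewrite H | easy].
- apply (is_derive_ext (fun s => Im (f s))); [intros s; now rewrite H | easy].
Qed.

Lemma cder_unique (f : R -> C) (t : R) (l1 l2 : C) :
  cder f t l1 -> cder f t l2 -> l1 = l2.
Proof.
intros [H1 H2] [H3 H4].
apply is_derive_unique in H1, H2, H3, H4.
apply injective_projections; unfold Re, Im in *; congruence.
Qed.

Lemma cder_affine (p q : C) (t : R) : cder (fun s => (p + s * q)%C) t q.
Proof.
destruct p as [a b], q as [c d]; split; simpl; auto_derive; auto; ring.
Qed.

Lemma cder_const (p : C) (t : R) : cder (fun _ => p) t (RtoC 0).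
Proof. split; apply (is_derive_const (V := R_NormedModule)). Qed.

Lemma cder_plus (f g : R -> C) (t : R) (a b : C) :
  cder f t a -> cder g t b -> cder (fun s => (f s + g s)%C) t (a + b)%C.
Proof.
intros [F1 F2] [G1 G2]; split.
- exact (is_derive_plus _ _ _ _ _ F1 G1).
- exact (is_derive_plus _ _ _ _ _ F2 G2).
Qed.

Lemma cder_minus (f g : R -> C) (t : R) (a b : C) :
  cder f t a -> cder g t b -> cder (fun s => (f s - g s)%C) t (a - b)%C.
Proof.
intros [F1 F2] [G1 G2]; split.
- exact (is_derive_minus _ _ _ _ _ F1 G1).
- exact (is_derive_minus _ _ _ _ _ F2 G2).
Qed.

Lemma cder_mult (f g : R -> C) (t : R) (a b : C) :
  cder f t a -> cder g t b ->
  cder (fun s => (f s * g s)%C) t (a * g t + f t * b)%C.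
Proof.
intros [F1 F2] [G1 G2].
assert (M : forall h k : R -> R, forall x y,
  is_derive h t x -> is_derive k t y ->
  is_derive (fun s => h s * k s) t (x * k t + h t * y)).
{ intros h k x y Hh Hk; apply (is_derive_mult h k); auto; intros; apply Rmult_comm. }
split.
- replace (Re (a * g t + f t * b)%C)
    with ((Re a * Re (g t) + Re (f t) * Re b) - (Im a * Im (g t) + Im (f t) * Im b))
    by (unfold Re, Im; simpl; ring).
  apply (is_derive_minus (fun s => Re (f s) * Re (g s)) (fun s => Im (f s) * Im (g s)));
  apply M; auto.
- replace (Im (a * g t + f t * b)%C)
    with ((Re a * Im (g t) + Re (f t) * Im b) + (Im a * Re (g t) + Im (f t) * Re b))
    by (unfold Re, Im; simpl; ring).
  apply (is_derive_plus (fun s => Re (f s) * Im (g s)) (fun s => Im (f s) * Re (g s)));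
  apply M; auto.
Qed.

Lemma cder_scal (c : C) (f : R -> C) (t : R) (l : C) :
  cder f t l -> cder (fun s => (c * f s)%C) t (c * l)%C.
Proof.
intros H; replace (c * l)%C with (0 * f t + c * l)%C by ring.
apply (cder_mult (fun _ => c)); auto using cder_const.
Qed.

Lemma norm2_neq_0 (z : C) : z <> RtoC 0 -> Re z ^ 2 + Im z ^ 2 <> 0.
Proof.
intros Hz H; apply Hz, Cmod_eq_0.
rewrite <- Cmod2_alt in H.
destruct (Req_dec (Cmod z) 0) as [E|E]; [easy|].
now apply (pow_nonzero _ 2) in E.
Qed.

Lemma cder_inv (f : R -> C) (t : R) (l : C) :
  f t <> RtoC 0 -> cder f t l ->
  cder (fun s => (/ f s)%C) t (- l * / f t * / f t)%C.
Proof.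
intros Hz [F1 F2].
assert (Hn := norm2_neq_0 _ Hz).
set (x := fun s => Re (f s)) in *; set (y := fun s => Im (f s)) in *.
assert (E1 : Derive (fun s => x s) t = Re l) by now apply is_derive_unique.
assert (E2 : Derive (fun s => y s) t = Im l) by now apply is_derive_unique.
assert (X1 : ex_derive x t) by (eexists; eauto).
assert (X2 : ex_derive y t) by (eexists; eauto).
change (x t ^ 2 + y t ^ 2 <> 0) in Hn.
split.
- change (is_derive (fun s => x s / (x s ^ 2 + y s ^ 2)) t
            (Re (- l * / (x t, y t) * / (x t, y t))%C)).
  auto_derive; [easy|]; rewrite E1, E2; unfold Re, Im; simpl in *; field;
  rewrite !Rmult_1_r in Hn; auto.
- change (is_derive (fun s => - y s / (x s ^ 2 + y s ^ 2)) t
            (Im (- l * / (x t, y t) * / (x t, y t))%C)).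
  auto_derive; [easy|]; rewrite E1, E2; unfold Re, Im; simpl in *; field;
  rewrite !Rmult_1_r in Hn; auto.
Qed.

Lemma Carg_pos (z : C) : 0 < Re z -> Carg z = atan (Im z / Re z).
Proof. intros H; unfold Carg; now destruct (Rlt_dec 0 (Re z)). Qed.

Lemma cder_log (f : R -> C) (t : R) (l : C) :
  0 < Re (f t) -> cder f t l -> cder (fun s => Clog (f s)) t (l / f t)%C.
Proof.
intros Hp [F1 F2].
set (x := fun s => Re (f s)) in *; set (y := fun s => Im (f s)) in *.
assert (E1 : Derive (fun s => x s) t = Re l) by now apply is_derive_unique.
assert (E2 : Derive (fun s => y s) t = Im l) by now apply is_derive_unique.
assert (X1 : ex_derive x t) by (eexists; eauto).
assert (X2 : ex_derive y t) by (eexists; eauto).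
change (0 < x t) in Hp.
assert (Hn : 0 < x t ^ 2 + y t ^ 2) by nra.
split.
- change (is_derive (fun s => ln (sqrt (x s ^ 2 + y s ^ 2))) t
            (Re (l / (x t, y t))%C)).
  assert (Hs := sqrt_lt_R0 _ Hn).
  assert (Hss : sqrt (x t ^ 2 + y t ^ 2) * sqrt (x t ^ 2 + y t ^ 2)
                = x t ^ 2 + y t ^ 2) by (apply sqrt_sqrt; lra).
  auto_derive; [simpl in *; tauto|]; rewrite E1, E2; simpl in *.
  transitivity ((x t * Re l + y t * Im l) /
    (sqrt (x t * (x t * 1) + y t * (y t * 1)) * sqrt (x t * (x t * 1) + y t * (y t * 1)))).
  + unfold Re, Im; field; lra.
  + rewrite Hss; unfold Re, Im; field; lra.
(* [Carg] is known to be [atan (y / x)] only where the real part is positive; by continuity this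
   holds near [t]. *)
- apply (is_derive_ext_loc (fun s => atan (y s / x s))).
  + assert (Hc := ex_derive_continuous x t X1).
    assert (Hx : locally (x t) (fun r => 0 < r)) by now apply open_gt.
    specialize (Hc _ Hx); revert Hc; unfold filtermap; apply filter_imp; intros s Hs.
    symmetry; now apply (Carg_pos (f s)).
  + change (Im (l / f t)%C) with (Im (l / (x t, y t))%C).
    auto_derive; [repeat split; auto; lra|]; rewrite E1, E2; unfold Re, Im; simpl.
    field; simpl in *; repeat split; nra.
Qed.

Lemma is_derive_path (f : C -> C) (p q : C) (t : R) (l : C) :
  is_derive (K := C_AbsRing) (V := C_NormedModule) f (p + t * q)%C l ->
  cder (fun s => f (p + s * q)%C) t (q * l)%C.
Proof.
intros [_ H].
specialize (H _ (fun P HP => HP)).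
assert (D : forall eps : posreal, locally t (fun s : R =>
  Cmod (f (p + s * q) - f (p + t * q) - (s - t)%R * (q * l))%C
  <= eps * Rabs (s - t))).
{ intros eps.
  (* The [+ 1] covers the case [q = 0]. *)
  assert (He : 0 < eps / (Cmod q + 1)).
  { apply Rdiv_lt_0_compat; [apply eps | generalize (Cmod_ge_0 q); lra]. }
  specialize (H (mkposreal _ He)).
  assert (Hc : filterlim (fun s : R => (p + s * q)%C) (locally t)
                 (locally (p + t * q)%C)).
  { destruct (cder_affine p q t) as [A B].
    apply filterlim_locally; intros e.
    assert (A' := ex_derive_continuous (V := R_NormedModule) _ _ (ex_intro _ _ A)).
    assert (B' := ex_derive_continuous (V := R_NormedModule) _ _ (ex_intro _ _ B)).
    generalize (filter_and _ _ (proj1 (filterlim_locally _ _) A' e)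
                  (proj1 (filterlim_locally _ _) B' e)).
    apply filter_imp; intros s [S1 S2]; now split. }
  (* The complex derivative refers to neighbourhoods for the modulus, [Hc] to those of the product
     structure; [locally_C] passes between them. *)
  apply locally_C in H.
  specialize (Hc _ H); revert Hc; unfold filtermap; apply filter_imp; intros s Hs.
  assert (Hq : minus (p + s * q)%C (p + t * q)%C = ((s - t)%R * q)%C).
  { unfold minus, plus, opp; simpl; rewrite RtoC_minus; ring. }
  match type of Hs with ?n1 <= _ => 
    change n1 with (Cmod (f (p + s * q) - f (p + t * q)
       - (minus (p + s * q)%C (p + t * q)%C) * l)%C) in Hs end.
  match type of Hs with _ <= _ * ?n1 => 
    change n1 with (Cmod (minus (p + s * q)%C (p + t * q)%C)) in Hs end.
  rewrite Hq in Hs.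
  rewrite Cmult_assoc.
  eapply Rle_trans; [exact Hs|].
  rewrite Cmod_mult, Cmod_R.
  replace (eps * Rabs (s - t)) 
    with (eps / (Cmod q + 1) * (Rabs (s - t) * (Cmod q + 1)))
    by (field; generalize (Cmod_ge_0 q); lra).
  apply Rmult_le_compat_l; [lra|].
  apply Rmult_le_compat_l; [apply Rabs_pos | lra]. }
split; (split; [apply is_linear_scal_l|]); intros x Hx eps;
  rewrite <- (is_filter_lim_locally_unique _ _ Hx);
  generalize (D eps); apply filter_imp; intros s Hs;
  (eapply Rle_trans; [|exact Hs]).
- eapply Rle_trans; [|apply re_le_Cmod].
  right; change norm with Rabs; f_equal.
  unfold minus, plus, opp, scal; simpl; unfold mult, Re, Im; simpl; ring.
- eapply Rle_trans; [|apply im_le_Cmod].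
  right; change norm with Rabs; f_equal.
  unfold minus, plus, opp, scal; simpl; unfold mult, Re, Im; simpl; ring.
Qed.

(** The factor 2 comes from applying the real inequality to the real and the imaginary part and
    adding. *)
Lemma cseries_mean_value (u v : nat -> R -> C) (c : nat -> R)
    (V g dg : R -> C) (phi dphi : R -> R) (a b : R) (Ua Ub : C) :
  a <= b ->
  ex_series c ->
  (forall k t, a <= t <= b -> cder (u k) t (v k t)) ->
  (forall k t, a <= t <= b -> Cmod (v k t) <= c k) ->
  (forall t, a <= t <= b ->
     is_series (K := C_AbsRing) (V := C_NormedModule) (fun k => v k t) (V t)) ->
  (forall t, a <= t <= b -> cder g t (dg t)) ->
  (forall t, a <= t <= b -> is_derive phi t (dphi t)) ->
  (forall t, a <= t <= b -> Cmod (V t - dg t)%C <= dphi t) ->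
  is_series (K := C_AbsRing) (V := C_NormedModule) (fun k => u k a) Ua ->
  is_series (K := C_AbsRing) (V := C_NormedModule) (fun k => u k b) Ub ->
  Cmod ((Ub - g b) - (Ua - g a))%C <= 2 * (phi b - phi a).
Proof.
intros Hab Hc Hu Hv HV Hg Hphi Hle HUa HUb.
apply is_seriesC in HUa, HUb; destruct HUa as [A1 A2], HUb as [B1 B2].
eapply Rle_trans; [apply Cmod_le_re_im|].
enough (Rabs (Re ((Ub - g b) - (Ua - g a))%C) <= phi b - phi a /\
        Rabs (Im ((Ub - g b) - (Ua - g a))%C) <= phi b - phi a) by lra.
split.
- apply (series_mean_value (fun k t => Re (u k t)) (fun k t => Re (v k t)) c
    (fun t => Re (V t)) (fun t => Re (g t)) (fun t => Re (dg t)) phi dphi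
    a b (Re Ua) (Re Ub)); auto.
  + intros; now apply Hu.
  + intros k t Ht; exact (Rle_trans _ _ _ (re_le_Cmod _) (Hv k t Ht)).
  + intros t Ht; now apply is_seriesC, HV.
  + intros; now apply Hg.
  + intros t Ht; exact (Rle_trans _ _ _ (re_le_Cmod _) (Hle t Ht)).
- apply (series_mean_value (fun k t => Im (u k t)) (fun k t => Im (v k t)) c
    (fun t => Im (V t)) (fun t => Im (g t)) (fun t => Im (dg t)) phi dphi
    a b (Im Ua) (Im Ub)); auto.
  + intros; now apply Hu.
  + intros k t Ht; exact (Rle_trans _ _ _ (im_le_Cmod _) (Hv k t Ht)).
  + intros t Ht; now apply is_seriesC, HV.
  + intros; now apply Hg.
  + intros t Ht; exact (Rle_trans _ _ _ (im_le_Cmod _) (Hle t Ht)).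
Qed.

(** * Cancellation between conjugate terms *)

Definition sumR (l : list R) : R := fold_right Rplus 0 l.

Lemma sumR_Permutation (l l' : list R) : Permutation l l' -> sumR l = sumR l'.
Proof. induction 1; simpl; lra. Qed.

Lemma sumR_app (l l' : list R) : sumR (l ++ l') = sumR l + sumR l'.
Proof. induction l as [|x l IH]; simpl; [|rewrite IH]; ring. Qed.

Lemma sum_n_sumR (u : nat -> R) (n : nat) :
  sum_n u n = sumR (map u (seq 0 (S n))).
Proof.
induction n as [|n IH].
- rewrite sum_O; simpl; ring.
- rewrite sum_Sn, IH, (seq_S (S n)), map_app, sumR_app; unfold plus; simpl; ring.
Qed.

Lemma length_filter_count_occ (alpha : nat -> C) (w : C) (l : list nat) :
  length (filter (fun k => if Ceq_dec (alpha k) w then true else false) l)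
  = count_occ Ceq_dec (map alpha l) w.
Proof.
induction l as [|k l IH]; [easy|]; simpl.
destruct (Ceq_dec (alpha k) w); simpl; congruence.
Qed.

(** With occurrences beyond [n] excluded, the list witnessing the multiplicity and the filtered
    prefix enumerate the same indices without repetition. *)
Lemma count_occ_prefix (alpha : nat -> C) (n : nat) (w : C) (m : nat) :
  (forall k, (n < k)%nat -> alpha k <> w) ->
  has_multiplicity alpha w m ->
  count_occ Ceq_dec (map alpha (seq 0 (S n))) w = m.
Proof.
intros Hk [l [Hl [<- Hin]]].
rewrite <- length_filter_count_occ.
apply Permutation_length, NoDup_Permutation; auto.
- apply NoDup_filter, seq_NoDup.
- intros k; rewrite filter_In, Hin, in_seq.
  destruct (Ceq_dec (alpha k) w) as [e|e]; split; try easy.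
  intros _; split; [|easy].
  destruct (Nat.lt_ge_cases n k) as [h|h]; [now apply Hk in h | lia].
Qed.

Lemma Re_mono (alpha : nat -> C) :
  (forall n, Re (alpha n) <= Re (alpha (S n))) ->
  forall n k, (n <= k)%nat -> Re (alpha n) <= Re (alpha k).
Proof.
intros H n k Hk; induction Hk as [|k Hk IH]; [lra|].
exact (Rle_trans _ _ _ IH (H k)).
Qed.

(** Since [Re] jumps after [n], a value [w] with [Re w <= Re (alpha n)] has all its occurrences in
    the prefix, and any other value has none. As [w] and its conjugate have the same real part, both
    counts are full multiplicities, equal by hypothesis, or both are 0. *)
Lemma prefix_conj (alpha : nat -> C) (n : nat) :
  (forall n, Re (alpha n) <= Re (alpha (S n))) ->
  (forall w, exists m, has_multiplicity alpha w m) ->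
  (forall w m, Im w <> 0 ->
    has_multiplicity alpha w m -> has_multiplicity alpha (Cconj w) m) ->
  Re (alpha n) < Re (alpha (S n)) ->
  Permutation (map alpha (seq 0 (S n))) (map Cconj (map alpha (seq 0 (S n)))).
Proof.
intros Hmono Hmult Hconj Hn.
apply (Permutation_count_occ Ceq_dec); intros w.
set (l := map alpha (seq 0 (S n))).
rewrite <- (Cconj_conj w) at 2.
rewrite <- (count_occ_map Cconj Ceq_dec Ceq_dec).
2: { intros x y H; now rewrite <- (Cconj_conj x), H, Cconj_conj. }
destruct (Req_dec (Im w) 0) as [H0|H0].
{ replace (Cconj w) with w; [easy|].
  destruct w as [x y]; simpl in H0; unfold Cconj; simpl; f_equal; lra. }
destruct (Rle_lt_dec (Re w) (Re (alpha n))) as [Hw|Hw].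
- destruct (Hmult w) as [m Hm].
  assert (big : forall w', Re w' = Re w ->
            forall k, (n < k)%nat -> alpha k <> w').
  { intros w' E k Hk E'; generalize (Re_mono alpha Hmono (S n) k Hk).
    rewrite E', E; lra. }
  unfold l; rewrite (count_occ_prefix alpha n w m); auto.
  rewrite (count_occ_prefix alpha n (Cconj w) m); auto.
- assert (none : forall w', Re w' = Re w -> count_occ Ceq_dec l w' = 0%nat).
  { intros w' E; apply count_occ_not_In; unfold l; rewrite in_map_iff.
    intros [k [Hk Hin]]; apply in_seq in Hin.
    assert (Hle : Re (alpha k) <= Re (alpha n)) by (apply Re_mono; auto; lia).
    rewrite Hk, E in Hle; lra. }
  now rewrite !none by auto using re_conj.
Qed.

(** Partial sums cut at a strict increase of [Re] vanish, because [f] changes sign under conjugation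
    and the prefix is stable under it. A convergent series with infinitely many vanishing partial
    sums has sum 0. *)
Lemma odd_series_zero (alpha : nat -> C) (f : C -> R) (l : R) :
  (forall n, Re (alpha n) <= Re (alpha (S n))) ->
  (forall w, exists m, has_multiplicity alpha w m) ->
  (forall w m, Im w <> 0 ->
    has_multiplicity alpha w m -> has_multiplicity alpha (Cconj w) m) ->
  (forall N, exists n, (N <= n)%nat /\ Re (alpha n) < Re (alpha (S n))) ->
  (forall n, f (Cconj (alpha n)) = - f (alpha n)) ->
  is_series (fun k => f (alpha k)) l -> l = 0.
Proof.
intros Hmono Hmult Hconj Hinf Hf Hl.
assert (Hz : forall n, Re (alpha n) < Re (alpha (S n)) ->
               sum_n (fun k => f (alpha k)) n = 0).
{ intros n Hn; rewrite sum_n_sumR, <- (map_map alpha f).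
  assert (P := prefix_conj alpha n Hmono Hmult Hconj Hn).
  apply (Permutation_map f), sumR_Permutation in P.
  rewrite (map_map Cconj f) in P.
  enough (sumR (map (fun w => f (Cconj w)) (map alpha (seq 0 (S n))))
          = - sumR (map f (map alpha (seq 0 (S n))))) by lra.
  rewrite !map_map.
  clear P; induction (seq 0 (S n)) as [|k s IH]; simpl; [ring|].
  rewrite IH, Hf; ring. }
destruct (Req_dec l 0) as [E|E]; [easy | exfalso].
destruct (proj2 (is_lim_seq_spec _ _) (is_lim_seq_sum_n _ _ Hl) (mkposreal _ (Rabs_pos_lt _ E))) as [N HN].
destruct (Hinf N) as [n [Hn Hlt]].
specialize (HN n Hn); rewrite (Hz n Hlt) in HN; simpl in HN.
rewrite <- Rabs_Ropp in HN; replace (- (0 - l)) with l in HN by ring; lra.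
Qed.

(** * The terms of the logarithmic derivative *)

(** The algebraic form of the conditions on a single term: for [Re w > 0], the bound
    [|arg w| < pi/4] says [|Im w| < Re w], that is, [w^2] has positive real part. *)
Definition wedge (w : C) : Prop := 1 < Re w /\ Rabs (Im w) < Re w.

Lemma riemann_wedge (E Bn : nat -> R) (alpha : nat -> C) (n : nat) :
  riemann_sequence E Bn alpha -> wedge (alpha n).
Proof.
intros H.
assert (H1 : 1 < Re (alpha n)).
{ generalize (rs_first _ _ _ H)
    (Re_mono alpha (rs_mono _ _ _ H) 0 n (Nat.le_0_l n)); lra. }
split; [easy|].
assert (Ha := rs_arg _ _ _ H n).
rewrite Carg_pos in Ha by lra.
rewrite <- atan_1 in Ha.
apply Rabs_def2 in Ha; destruct Ha as [A B].
rewrite <- atan_opp in B.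
assert (L : forall x y, atan x < atan y -> x < y).
{ intros x y h; destruct (Rlt_le_dec x y) as [k|[k|k]]; [easy| |].
  - apply atan_increasing in k; lra.
  - subst; lra. }
apply L in A; apply L in B.
set (x := Re (alpha n)) in *; set (y := Im (alpha n)) in *.
assert (Ey : y = y / x * x) by (field; lra).
apply Rabs_def1; rewrite Ey; nra.
Qed.

Lemma sq_sum_factor (z w : C) :
  (z ^ 2 + w ^ 2 = (z + Ci * w) * (z - Ci * w))%C.
Proof.
destruct z as [a b], w as [c d]; unfold Ci; simpl.
apply injective_projections; simpl; ring.
Qed.

Lemma quotient_bound (z w : C) (m : R) :
  0 < m -> m <= Cmod (z + Ci * w) -> m <= Cmod (z - Ci * w) ->
  Cmod (2 * z / (z ^ 2 + w ^ 2)) <= 2 * Cmod z / m ^ 2.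
Proof.
intros Hm H1 H2.
assert (Hd : m ^ 2 <= Cmod (z ^ 2 + w ^ 2)).
{ rewrite sq_sum_factor, Cmod_mult; simpl; rewrite Rmult_1_r.
  apply Rmult_le_compat; lra. }
assert (Hm2 : 0 < m ^ 2) by (apply pow_lt; lra).
rewrite Cmod_div.
2: { intros E; rewrite E, Cmod_0 in Hd; lra. }
rewrite Cmod_mult, Cmod_R, (Rabs_pos_eq 2) by lra.
apply Rmult_le_compat_l; [generalize (Cmod_ge_0 z); lra|].
now apply Rinv_le_contravar.
Qed.

(** For real [x] the imaginary parts of [x + iw] and [x - iw] are [Re w] and [- Re w], so both
    factors of the denominator have modulus at least [Re w]. *)
Lemma quotient_bound_real (x : R) (w : C) :
  0 <= x -> wedge w ->
  Cmod (2 * x / (x ^ 2 + w ^ 2)) <= 2 * x / (Re w) ^ 2.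
Proof.
intros Hx [H1 H2].
rewrite <- (Rabs_pos_eq x Hx) at 3; rewrite <- Cmod_R.
apply quotient_bound; [lra| |].
- eapply Rle_trans; [|apply im_le_Cmod].
  destruct w as [r s]; simpl in *.
  replace (0 + (0 * s + 1 * r)) with r by ring; apply Rle_abs.
- eapply Rle_trans; [|apply im_le_Cmod].
  destruct w as [r s]; simpl in *.
  replace (0 + - (0 * s + 1 * r)) with (- r) by ring.
  rewrite Rabs_Ropp; apply Rle_abs.
Qed.

(* [|z +- iw|] is at least [d], from the real parts, and at least [Re w - Y],
   from the imaginary parts; averaging gives a bound linear in [Re w]. *)
Lemma quotient_bound_strip (z w : C) (d Y : R) :
  wedge w -> 0 < d -> Rabs (Im z) <= Y -> d + Rabs (Im w) <= Re z ->
  Cmod (2 * z / (z ^ 2 + w ^ 2)) <= 2 * Cmod z * ((d + Y) / d) ^ 2 / (Re w) ^ 2.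
Proof.
intros [H1 H2] Hd HY Hz.
assert (HY0 : 0 <= Y) by (generalize (Rabs_pos (Im z)); lra).
replace (2 * Cmod z * ((d + Y) / d) ^ 2 / Re w ^ 2)
  with (2 * Cmod z / (d * Re w / (d + Y)) ^ 2) by (field; lra).
(* The weights are [d] for the bound [Re w - Y] and [Y] for the bound [d]: their combination is
   exactly [d * Re w]. *)
assert (key : forall v, d <= Rabs (Re v) -> Re w - Y <= Rabs (Im v) ->
                d * Re w / (d + Y) <= Cmod v).
{ intros v A B.
  assert (A' := Rle_trans _ _ _ A (re_le_Cmod v)).
  assert (B' := Rle_trans _ _ _ B (im_le_Cmod v)).
  apply (Rmult_le_reg_r (d + Y)); [lra|].
  replace (d * Re w / (d + Y) * (d + Y)) with (d * Re w) by (field; lra).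
  nra. }
assert (a1 := Rle_abs (Im w)); assert (a2 := Rle_abs (- Im w)).
assert (a3 := Rle_abs (Im z)); assert (a4 := Rle_abs (- Im z)).
rewrite Rabs_Ropp in a2, a4.
apply quotient_bound.
- apply Rdiv_lt_0_compat; [apply Rmult_lt_0_compat|]; lra.
- destruct w as [r s], z as [x y]; unfold Re, Im in *; apply key; simpl in *.
  + replace (x + (0 * r - 1 * s)) with (x - s) by ring.
    eapply Rle_trans; [|apply Rle_abs]; lra.
  + replace (y + (0 * s + 1 * r)) with (y + r) by ring.
    eapply Rle_trans; [|apply Rle_abs]; lra.
- destruct w as [r s], z as [x y]; unfold Re, Im in *; apply key; simpl in *.
  + replace (x + - (0 * r - 1 * s)) with (x + s) by ring.
    eapply Rle_trans; [|apply Rle_abs]; lra.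
  + replace (y + - (0 * s + 1 * r)) with (- (r - y)) by ring.
    rewrite Rabs_Ropp; eapply Rle_trans; [|apply Rle_abs]; lra.
Qed.

(** The real part is [2 x A / D], where [A = Re (x^2 + w^2)] and [D = |x^2 + w^2|^2]. The condition
    [|Im w| <= x] gives [A >= (Re w)^2], while [D] is of order [(Re w)^4] for fixed [x]. *)
Lemma quotient_re_lower (x : R) (w : C) :
  0 < x -> wedge w -> Rabs (Im w) <= x ->
  / (Re w) ^ 2 <= (x ^ 2 + 2) ^ 2 / (2 * x) * Re (2 * x / (x ^ 2 + w ^ 2)).
Proof.
intros Hx [H1 H2] H3.
assert (H2' : Im w ^ 2 < Re w ^ 2).
{ rewrite <- (pow2_abs (Im w)); generalize (Rabs_pos (Im w)); nra. }
assert (H3' : Im w ^ 2 <= x ^ 2).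
{ rewrite <- (pow2_abs (Im w)); generalize (Rabs_pos (Im w)); nra. }
destruct w as [r s].
change (Re (r, s)) with r in *; change (Im (r, s)) with s in *.
set (A := x ^ 2 + r ^ 2 - s ^ 2).
assert (HA : r ^ 2 <= A) by (unfold A; lra).
set (D := A ^ 2 + (2 * r * s) ^ 2).
(* From [1 <= r^2] and [s^2 <= r^2] one gets [D <= (x^4 + 2 x^2 + 4) r^4], and the factor is at most
   [(x^2 + 2)^2]. *)
assert (HD : D <= ((x ^ 2 + 2) * r ^ 2) ^ 2).
{ unfold D, A.
  replace ((x ^ 2 + r ^ 2 - s ^ 2) ^ 2 + (2 * r * s) ^ 2)
    with (x ^ 4 + 2 * x ^ 2 * (r ^ 2 - s ^ 2) + (r ^ 2 + s ^ 2) ^ 2) by ring.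
  assert (E1 : 1 <= r ^ 2) by nra.
  assert (E2 : 0 <= s ^ 2) by apply pow2_ge_0.
  assert (E3 : 0 <= x ^ 2) by apply pow2_ge_0.
  assert (E4 : x ^ 4 = x ^ 2 * x ^ 2) by ring.
  rewrite E4.
  set (X := x ^ 2) in *; set (Y := s ^ 2) in *; set (Q := r ^ 2) in *.
  assert (F1 : Q <= Q * Q) by nra.
  assert (F2 : X * X <= X * X * (Q * Q)).
  { rewrite <- (Rmult_1_r (X * X)) at 1; apply Rmult_le_compat_l; nra. }
  assert (F3 : X * (Q - Y) <= X * (Q * Q)) by (apply Rmult_le_compat_l; lra).
  nra. }
assert (HD0 : 0 < D) by (unfold D; nra).
replace (Re (2 * x / (x ^ 2 + (r, s) ^ 2))) with (2 * x * A / D).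
2: { unfold D, A in *; simpl; field; nra. }
replace ((x ^ 2 + 2) ^ 2 / (2 * x) * (2 * x * A / D))
  with ((x ^ 2 + 2) ^ 2 * A / D) by (field; lra).
apply (Rmult_le_reg_r D); [easy|].
replace ((x ^ 2 + 2) ^ 2 * A / D * D) with ((x ^ 2 + 2) ^ 2 * A) by (field; lra).
apply Rle_trans with (/ r ^ 2 * ((x ^ 2 + 2) * r ^ 2) ^ 2).
- apply Rmult_le_compat_l; [|easy]. left; apply Rinv_0_lt_compat; nra.
- replace (/ r ^ 2 * ((x ^ 2 + 2) * r ^ 2) ^ 2) with ((x ^ 2 + 2) ^ 2 * r ^ 2)
    by (field; lra).
  apply Rmult_le_compat_l; [apply pow2_ge_0 | easy].
Qed.

Lemma inv_sq_summable (alpha : nat -> C) (F : C -> C) (a M : R) :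
  0 < M -> (forall n, wedge (alpha n)) -> (forall n, Rabs (Im (alpha n)) < M) ->
  (forall z : C, a < Re z ->
     is_series (K := C_AbsRing) (V := C_NormedModule)
       (fun k => (2 * z / (z ^ 2 + alpha k ^ 2))%C) (F z)) ->
  ex_series (fun k => / Re (alpha k) ^ 2).
Proof.
intros HM Hw HI HF.
(* [x >= M] puts every [|Im alpha_k|] below [x], as the lower bound requires; [x > a] gives
   convergence at [x]. *)
set (x := Rmax M (a + 1)).
assert (x1 : M <= x) by apply Rmax_l.
assert (x2 : a + 1 <= x) by apply Rmax_r.
assert (Hx : a < Re x) by (simpl; lra).
specialize (HF (RtoC x) Hx); apply is_seriesC in HF; destruct HF as [HF _].
apply (ex_series_le (V := R_CompleteNormedModule) _
  (fun k => (x ^ 2 + 2) ^ 2 / (2 * x) * Re (2 * x / (x ^ 2 + alpha k ^ 2)))).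
- intros k; change norm with Rabs.
  rewrite Rabs_pos_eq.
  + apply quotient_re_lower; auto; [lra|].
    generalize (HI k); lra.
  + left; apply Rinv_0_lt_compat, pow_lt; destruct (Hw k); lra.
- apply (ex_series_scal (V := R_NormedModule)); eexists; exact HF.
Qed.

(** Otherwise [Re alpha_k] would be constant from [N] on, and the terms of the convergent series
    would not tend to 0. *)
Lemma Re_increases (alpha : nat -> C) :
  (forall n, wedge (alpha n)) ->
  (forall n, Re (alpha n) <= Re (alpha (S n))) ->
  ex_series (fun k => / Re (alpha k) ^ 2) ->
  forall N, exists n, (N <= n)%nat /\ Re (alpha n) < Re (alpha (S n)).
Proof.
intros Hw Hmono Hs N.
apply NNPP; intros Hno.
assert (Hc : forall k, Re (alpha (N + k)%nat) = Re (alpha N)).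
{ induction k as [|k IH]; [now rewrite Nat.add_0_r|].
  rewrite <- IH, Nat.add_succ_r.
  destruct (Hmono (N + k)%nat) as [h|h]; [|easy].
  exfalso; apply Hno; exists (N + k)%nat; split; [lia | easy]. }
assert (Hp : 0 < / Re (alpha N) ^ 2).
{ apply Rinv_0_lt_compat, pow_lt; destruct (Hw N); lra. }
apply ex_series_lim_0, is_lim_seq_spec in Hs.
destruct (Hs (mkposreal _ Hp)) as [K HK].
specialize (HK (N + K)%nat ltac:(lia)); simpl in HK.
rewrite Hc, Rminus_0_r, Rabs_pos_eq in HK; simpl in *; lra.
Qed.

(** * Branches of the logarithm along segments *)

Lemma cder_exp (f : R -> C) (t : R) (l : C) :
  cder f t l -> cder (fun s => Cexp (f s)) t (l * Cexp (f t))%C.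
Proof.
intros [F1 F2].
set (x := fun s => Re (f s)) in *; set (y := fun s => Im (f s)) in *.
assert (E1 : Derive (fun s => x s) t = Re l) by now apply is_derive_unique.
assert (E2 : Derive (fun s => y s) t = Im l) by now apply is_derive_unique.
assert (X1 : ex_derive x t) by (eexists; eauto).
assert (X2 : ex_derive y t) by (eexists; eauto).
split.
- change (is_derive (fun s => exp (x s) * cos (y s)) t
    (fst l * (exp (x t) * cos (y t)) - snd l * (exp (x t) * sin (y t)))).
  auto_derive; [easy|]; rewrite E1, E2; unfold Re, Im; ring.
- change (is_derive (fun s => exp (x s) * sin (y s)) t
    (fst l * (exp (x t) * sin (y t)) + snd l * (exp (x t) * cos (y t)))).
  auto_derive; [easy|]; rewrite E1, E2; unfold Re, Im; ring.
Qed.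

Lemma Cexp_neq_0 (z : C) : Cexp z <> RtoC 0.
Proof.
intros H; injection H as H1 H2.
generalize (exp_pos (Re z)) (sin2_cos2 (Im z)); intros H3 H4.
apply Rmult_integral in H1, H2; unfold Rsqr in H4.
destruct H1 as [H1|H1], H2 as [H2|H2]; try lra.
rewrite H1, H2 in H4; lra.
Qed.

(** Both sides of [Cexp (L z) = 1 + z^2/w^2] are differentiated along the line and compared. Since
    the exponential has no zeros, [1 + z^2/w^2] and with it [z^2 + w^2] are nonzero on [D], which
    permits the division. *)
Lemma log_branch_path (D : C -> Prop) (w : C) (L : C -> C) (p q : C) (t : R) :
  w <> RtoC 0 ->
  is_log_branch D (fun z => (1 + z ^ 2 / w ^ 2)%C) L ->
  (forall s : R, D (p + s * q)%C) ->
  cder (fun s => L (p + s * q)%C) t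
    (q * (2 * (p + t * q) / ((p + t * q) ^ 2 + w ^ 2)))%C.
Proof.
intros Hw [HL _] HD.
destruct (proj1 (HL _ (HD t))) as [l Hl].
apply is_derive_path in Hl.
set (z := (p + t * q)%C) in *.
assert (Hexp : Cexp (L z) = (1 + z ^ 2 / w ^ 2)%C) by apply HL, HD.
assert (Hz : (1 + z ^ 2 / w ^ 2)%C <> RtoC 0).
{ rewrite <- Hexp; apply Cexp_neq_0. }
assert (H1 := cder_exp _ _ _ Hl).
assert (H2 : cder (fun s => Cexp (L (p + s * q)%C)) t (2 * z * q / w ^ 2)%C).
{ apply (cder_ext (fun s => (1 + / w ^ 2 * ((p + s * q) * (p + s * q)))%C)).
  - intros s; rewrite (proj2 (HL _ (HD s))); unfold Cdiv; ring.
  - replace (2 * z * q / w ^ 2)%C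
      with (0 + / w ^ 2 * (q * (p + t * q) + (p + t * q) * q))%C
      by (unfold z, Cdiv; ring).
    apply cder_plus; [apply cder_const|].
    apply cder_scal, cder_mult; apply cder_affine. }
assert (E := cder_unique _ _ _ _ H1 H2); simpl in E.
fold z in E; rewrite Hexp in E.
assert (Hw2 : (w ^ 2)%C <> RtoC 0) by now apply Cpow_nz.
assert (Hs : (z ^ 2 + w ^ 2)%C <> RtoC 0).
{ intros H; apply Hz.
  replace (1 + z ^ 2 / w ^ 2)%C with ((z ^ 2 + w ^ 2) / w ^ 2)%C by now field.
  rewrite H; now field. }
replace (q * (2 * z / (z ^ 2 + w ^ 2)))%C with (q * l)%C; [easy|].
replace (q * l)%C with (q * l * (1 + z ^ 2 / w ^ 2) * (w ^ 2 / (z ^ 2 + w ^ 2)))%C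
  by (field; split; easy).
rewrite E; field; split; easy.
Qed.

Lemma cmean_value (f df : R -> C) (a b K : R) :
  a <= b ->
  (forall t, a <= t <= b -> cder f t (df t)) ->
  (forall t, a <= t <= b -> Cmod (df t) <= K) ->
  Cmod (f b - f a) <= 2 * (K * (b - a)).
Proof.
intros Hab Hf Hle.
eapply Rle_trans; [apply Cmod_le_re_im|].
assert (HK : forall t, is_derive (fun s => K * s) t K)
  by (intros; auto_derive; [easy | ring]).
enough (Rabs (Re (f b - f a)) <= K * b - K * a /\
        Rabs (Im (f b - f a)) <= K * b - K * a) by lra.
split.
- apply (mean_value_le (fun s => Re (f s)) (fun s => Re (df s))
           (fun s => K * s) (fun _ => K)); auto.
  + intros t Ht; apply (Hf t Ht).
  + intros t Ht; exact (Rle_trans _ _ _ (re_le_Cmod _) (Hle t Ht)).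
- apply (mean_value_le (fun s => Im (f s)) (fun s => Im (df s))
           (fun s => K * s) (fun _ => K)); auto.
  + intros t Ht; apply (Hf t Ht).
  + intros t Ht; exact (Rle_trans _ _ _ (im_le_Cmod _) (Hle t Ht)).
Qed.

Lemma region_real (M s : R) : log_region M (0 + s * 1)%C.
Proof. right; simpl; rewrite Rabs_pos_eq; lra. Qed.

Lemma region_vertical (M x y s : R) :
  M < x -> log_region M (x + s * (Ci * y))%C.
Proof. intros H; left; simpl; lra. Qed.

Lemma wedge_neq_0 (w : C) : wedge w -> w <> RtoC 0.
Proof. intros [H _] E; rewrite E in H; simpl in H; lra. Qed.

(** A majorant independent of [t] and summable over the sequence, for the vertical segment from [x]
    to [x + iy]; the factor [Rabs y] is the speed of the parametrization. *)
Lemma vertical_bound (x y d t : R) (w : C) :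
  wedge w -> 0 < d -> d + Rabs (Im w) <= x -> 0 <= t <= 1 ->
  Cmod (Ci * y * (2 * (x + t * (Ci * y)) /
          ((x + t * (Ci * y)) ^ 2 + w ^ 2)))%C
  <= Rabs y * (2 * (x + Rabs y) * ((d + Rabs y) / d) ^ 2) * / Re w ^ 2.
Proof.
intros Hw Hd Hx Ht.
assert (Hy := Rabs_pos y).
assert (Hz : Rabs (t * y) <= Rabs y).
{ rewrite Rabs_mult, (Rabs_pos_eq t) by lra; nra. }
assert (Hr : 0 < / Re w ^ 2).
{ apply Rinv_0_lt_compat, pow_lt; destruct Hw; lra. }
rewrite !Cmod_mult, Cmod_Ci, Cmod_R, Rmult_1_l, Rmult_assoc.
apply Rmult_le_compat_l; [easy|].
assert (HI : Im (x + t * (Ci * y))%C = t * y) by (simpl; ring).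
assert (HR : Re (x + t * (Ci * y))%C = x) by (simpl; ring).
eapply Rle_trans.
- apply (quotient_bound_strip _ w d (Rabs y)); auto.
  + now rewrite HI.
  + now rewrite HR.
- unfold Rdiv at 1; apply Rmult_le_compat_r; [lra|].
  apply Rmult_le_compat_r; [apply pow2_ge_0|].
  apply Rmult_le_compat_l; [lra|].
  eapply Rle_trans; [apply Cmod_le_re_im|].
  rewrite HI, HR, (Rabs_pos_eq x); [lra|].
  generalize (Rabs_pos (Im w)); lra.
Qed.

(** The normalization [L 0 = 0] makes [L x] an increment along the real axis, to which the mean
    value inequality applies. *)
Lemma log_branch_bound_real (M : R) (w : C) (L : C -> C) (x : R) :
  wedge w ->
  is_log_branch (log_region M) (fun z => (1 + z ^ 2 / w ^ 2)%C) L ->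
  0 <= x -> Cmod (L x) <= 4 * x ^ 2 * / Re w ^ 2.
Proof.
intros Hw HL Hx.
assert (H := cmean_value (fun s => L (0 + s * 1)%C)
  (fun t => (1 * (2 * (0 + t * 1) / ((0 + t * 1) ^ 2 + w ^ 2)))%C)
  0 x (2 * x / Re w ^ 2) Hx).
replace (L x) with (L (0 + x * 1) - L (0 + 0 * 1))%C.
2: { replace (0 + 0 * 1)%C with (RtoC 0) by ring; rewrite (proj2 HL).
  replace (0 + x * 1)%C with (RtoC x) by ring; ring. }
eapply Rle_trans; [apply H|].
- intros t Ht; apply (log_branch_path (log_region M)); auto using wedge_neq_0.
  intros; apply region_real.
- intros t Ht; rewrite Cmult_1_l.
  replace (0 + t * 1)%C with (RtoC t) by ring.
  eapply Rle_trans; [apply quotient_bound_real; auto; lra|].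
  apply Rmult_le_compat_r; [|lra].
  left; apply Rinv_0_lt_compat, pow_lt; destruct Hw; lra.
- right; field; destruct Hw; lra.
Qed.

Lemma log_branch_bound (M : R) (z : C) :
  0 < M < Re z -> exists K, forall (w : C) (L : C -> C),
  wedge w -> Rabs (Im w) < M ->
  is_log_branch (log_region M) (fun z => (1 + z ^ 2 / w ^ 2)%C) L ->
  Cmod (L z) <= K * / Re w ^ 2.
Proof.
intros HM.
destruct z as [x y]; simpl in HM.
(* The first summand bounds the increment on the vertical segment above [x], at distance [x - M]
   from the strip bound; the second bounds [L x]. *)
exists (2 * (Rabs y * (2 * (x + Rabs y) * ((x - M + Rabs y) / (x - M)) ^ 2))
        + 4 * x ^ 2).
intros w L Hw HI HL.
replace (L (x, y)) with ((L (x + 1 * (Ci * y)) - L (x + 0 * (Ci * y))) + L x)%C.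
2: { replace (x + 0 * (Ci * y))%C with (RtoC x) by ring.
  replace (x + 1 * (Ci * y))%C with ((x, y) : C); [ring|].
  apply injective_projections; simpl; ring. }
eapply Rle_trans; [apply Cmod_triangle|].
rewrite Rmult_plus_distr_r; apply Rplus_le_compat.
- rewrite Rmult_assoc.
  assert (H := cmean_value (fun s => L (x + s * (Ci * y))%C)
    (fun t => (Ci * y * (2 * (x + t * (Ci * y)) / ((x + t * (Ci * y)) ^ 2 + w ^ 2)))%C)
    0 1 (Rabs y * (2 * (x + Rabs y) * ((x - M + Rabs y) / (x - M)) ^ 2) * / Re w ^ 2)).
  rewrite Rminus_0_r, Rmult_1_r in H; apply H; [lra| |].
  + intros t Ht; apply (log_branch_path (log_region M)); auto using wedge_neq_0.
    intros; apply region_vertical; lra.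
  + intros t Ht; apply vertical_bound; auto; lra.
- apply (log_branch_bound_real M); auto; lra.
Qed.

Lemma log_series_converges (alpha : nat -> C) (M : R) (L : nat -> C -> C) (z : C) :
  (forall n, wedge (alpha n)) -> (forall n, Rabs (Im (alpha n)) < M) ->
  ex_series (fun k => / Re (alpha k) ^ 2) ->
  (forall n, is_log_branch (log_region M)
     (fun z => (1 + z ^ 2 / alpha n ^ 2)%C) (L n)) ->
  0 < M < Re z ->
  is_series (K := C_AbsRing) (V := C_NormedModule)
    (fun n => L n z) (CSeries (fun n => L n z)).
Proof.
intros Hw HI Hs HL Hz.
destruct (log_branch_bound M z Hz) as [K HK].
apply (CSeries_correct _ (fun k => K * / Re (alpha k) ^ 2)).
- now apply (ex_series_scal (V := R_NormedModule)).
- intros k; now apply HK.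
Qed.

(** The branches are indexed by [n] and not given as one function of [alpha n], so the cancellation
    is applied to the derivatives, which are. The imaginary part of the differentiated sum is 0 on
    [[0, x]]; the mean value inequality with majorant 0 then keeps that of the sum at its value 0 at
    the origin. *)
Lemma Im_log_series (alpha : nat -> C) (M : R) (L : nat -> C -> C) (x : R) (l : C) :
  (forall n, wedge (alpha n)) ->
  (forall n, Re (alpha n) <= Re (alpha (S n))) ->
  (forall w, exists m, has_multiplicity alpha w m) ->
  (forall w m, Im w <> 0 ->
    has_multiplicity alpha w m -> has_multiplicity alpha (Cconj w) m) ->
  ex_series (fun k => / Re (alpha k) ^ 2) ->
  (forall n, is_log_branch (log_region M)
     (fun z => (1 + z ^ 2 / alpha n ^ 2)%C) (L n)) ->
  0 <= x ->
  is_series (K := C_AbsRing) (V := C_NormedModule) (fun n => L n x) l ->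
  Im l = 0.
Proof.
intros Hw Hmono Hmult Hconj Hs HL Hx Hl.
assert (Hb : forall k t, 0 <= t <= x ->
  Cmod (2 * t / (t ^ 2 + alpha k ^ 2)) <= 2 * x * / Re (alpha k) ^ 2).
{ intros k t Ht; eapply Rle_trans; [apply quotient_bound_real; auto; lra|].
  apply Rmult_le_compat_r; [|lra].
  left; apply Rinv_0_lt_compat, pow_lt; destruct (Hw k); lra. }
assert (Hc : ex_series (fun k => 2 * x * / Re (alpha k) ^ 2))
  by now apply (ex_series_scal (V := R_NormedModule)).
assert (H := series_mean_value (fun k t => Im (L k (0 + t * 1)%C))
  (fun k t => Im (2 * t / (t ^ 2 + alpha k ^ 2)))
  (fun k => 2 * x * / Re (alpha k) ^ 2)
  (fun _ => 0) (fun _ => 0) (fun _ => 0) (fun _ => 0) (fun _ => 0)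
  0 x 0 (Im l) Hx Hc).
enough (Rabs (Im l - 0 - (0 - 0)) <= 0 - 0) as H0.
{ replace (Im l - 0 - (0 - 0)) with (Im l) in H0 by ring.
  destruct (Req_dec (Im l) 0) as [e|e]; [easy|].
  apply Rabs_pos_lt in e; lra. }
apply H; clear H.
- intros k t Ht.
  assert (D := log_branch_path (log_region M) (alpha k) (L k) 0 1 t
    (wedge_neq_0 _ (Hw k)) (HL k) (region_real M)).
  replace (0 + t * 1)%C with (RtoC t) in D by ring.
  rewrite Cmult_1_l in D; apply D.
- intros k t Ht; exact (Rle_trans _ _ _ (im_le_Cmod _) (Hb k t Ht)).
- intros t Ht.
  assert (Ht' := CSeries_correct _ _ Hc (fun k => Hb k t Ht)).
  apply is_seriesC in Ht'; destruct Ht' as [_ Ht'].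
  assert (E : Im (CSeries (fun k => (2 * t / (t ^ 2 + alpha k ^ 2))%C)) = 0).
  { apply (odd_series_zero alpha (fun w => Im (2 * t / (t ^ 2 + w ^ 2)))); auto.
    - now apply Re_increases.
    - intros n; rewrite <- im_conj.
      rewrite Cdiv_conj.
      + rewrite Cplus_conj, Cmult_conj, !Cpow_conj.
        replace (Cconj t) with (RtoC t)
          by (unfold Cconj; apply injective_projections; simpl; ring).
        replace (Cconj 2) with (RtoC 2)
          by (unfold Cconj; apply injective_projections; simpl; ring).
        easy.
      (* The denominator has real part [t^2 + (r - s)(r + s) > 0]. *)
      + intros E0; apply (f_equal Re) in E0.
        destruct (Hw n) as [w1 w2].
        destruct (alpha n) as [r s]; simpl in *.
        apply Rabs_def2 in w2.
        assert (0 < (r - s) * (r + s)) by (apply Rmult_lt_0_compat; lra).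
        generalize (Rle_0_sqr t); unfold Rsqr; lra. }
  rewrite E in Ht'; exact Ht'.
- intros; apply (is_derive_const (V := R_NormedModule)).
- intros; apply (is_derive_const (V := R_NormedModule)).
- intros; rewrite Rminus_0_r, Rabs_R0; lra.
- apply (is_series_ext (fun _ => 0)).
  + intros n; replace (0 + 0 * 1)%C with (RtoC 0) by ring.
    now rewrite (proj2 (HL n)).
  + apply filterlim_ext with (fun _ => 0); [|apply filterlim_const].
    intros n; symmetry; rewrite sum_n_const; ring.
- apply is_seriesC in Hl; destruct Hl as [_ Hl].
  apply (is_series_ext (fun n => Im (L n x))); [|easy].
  intros n; now replace (0 + x * 1)%C with (RtoC x) by ring.
Qed.

(** * Sectors and limits at infinity *)

Lemma filterlim_sector (eps : R) (h : C -> C) :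
  filterlim h (within (sector eps) C_infty) (locally (RtoC 0)) <->
  forall eta, 0 < eta -> exists X, forall z,
    X < Cmod z -> sector eps z -> Cmod (h z) < eta.
Proof.
split.
- intros H eta Heta.
  (* Balls in [C] are products of intervals; halving makes [|Re| + |Im|] smaller than [eta]. *)
  assert (He : 0 < eta / 2) by lra.
  destruct (proj1 (filterlim_locally _ _) H (mkposreal _ He)) as [X HX].
  exists X; intros z Hz Hs; destruct (HX z Hz Hs) as [B1 B2].
  unfold ball in B1, B2; simpl in B1, B2.
  unfold AbsRing_ball, abs, minus, plus, opp in B1, B2; simpl in B1, B2.
  rewrite Ropp_0, Rplus_0_r in B1, B2.
  eapply Rle_lt_trans; [apply Cmod_le_re_im|]; unfold Re, Im; lra.
- intros H; apply filterlim_locally; intros e.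
  destruct (H e (cond_pos e)) as [X HX]; exists X; intros z Hz Hs.
  specialize (HX z Hz Hs).
  apply C_NormedModule_mixin_compat1.
  replace (minus (h z) (RtoC 0)) with (h z); [easy|].
  unfold minus, plus, opp; simpl; ring.
Qed.

(** Outside [Re z > 0] a nonzero [z] has [|Carg z| >= pi/2]. The origin must be excluded because the
    value of [Carg] there would place it in every sector. *)
Lemma sector_pos (eps : R) (z : C) :
  0 < eps < PI / 2 -> 0 < Cmod z -> sector eps z ->
  0 < Re z /\ Rabs (Im z) <= tan (PI / 2 - eps) * Re z.
Proof.
intros He Hz; unfold sector, Carg.
assert (B := fun x => atan_bound x).
destruct (Rlt_dec 0 (Re z)) as [h|h].
- intros Hs; split; [easy|].
  set (T := tan (PI / 2 - eps)).
  assert (HT : atan T = PI / 2 - eps) by (apply atan_tan; lra).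
  rewrite <- HT in Hs.
  assert (L : forall x y, atan x <= atan y -> x <= y).
  { intros x y k; destruct (Rlt_le_dec y x) as [k'|k']; [|easy].
    apply atan_increasing in k'; lra. }
  assert (H1 : Im z / Re z <= T).
  { apply L; generalize (Rle_abs (atan (Im z / Re z))); lra. }
  assert (H2 : - (Im z / Re z) <= T).
  { apply L; rewrite atan_opp.
    generalize (Rle_abs (- atan (Im z / Re z))); rewrite Rabs_Ropp; lra. }
  assert (E : Im z = Im z / Re z * Re z) by (field; lra).
  apply Rabs_le; rewrite E; split; nra.
- intros Hs; exfalso.
  destruct (Rlt_dec (Re z) 0) as [k|k].
  + generalize (B (Im z / Re z)); intros [b1 b2].
    generalize (Rle_abs (atan (Im z / Re z) + PI))
               (Rle_abs (- (atan (Im z / Re z) - PI))).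
    rewrite Rabs_Ropp; destruct (Rle_dec 0 (Im z)); lra.
  + assert (E : Re z = 0) by lra.
    destruct (Rlt_dec 0 (Im z)) as [i|i].
    { rewrite Rabs_pos_eq in Hs; lra. }
    destruct (Rlt_dec (Im z) 0) as [j|j].
    { rewrite Rabs_Ropp, Rabs_pos_eq in Hs; lra. }
    assert (E' : Im z = 0) by lra.
    destruct z as [x y]; unfold Re, Im in *; simpl in *; subst.
    change (0, 0) with (RtoC 0) in Hz; rewrite Cmod_0 in Hz; lra.
Qed.

Lemma sector_intro (eps : R) (z : C) :
  0 < eps < PI / 2 -> 0 < Re z ->
  Rabs (Im z) <= tan (PI / 2 - eps) * Re z -> sector eps z.
Proof.
intros He Hz Hi; unfold sector; rewrite Carg_pos by easy.
set (T := tan (PI / 2 - eps)) in *.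
assert (HT : atan T = PI / 2 - eps) by (apply atan_tan; lra).
rewrite <- HT.
assert (L : forall x y, x <= y -> atan x <= atan y).
{ intros x y [k|k]; [left; now apply atan_increasing | rewrite k; lra]. }
assert (a1 := Rle_abs (Im z)); assert (a2 := Rle_abs (- Im z)).
rewrite Rabs_Ropp in a2.
apply Rabs_le; rewrite <- atan_opp; split; apply L.
- apply (Rmult_le_reg_r (Re z)); [easy|].
  unfold Rdiv; rewrite Rmult_assoc, Rinv_l; lra.
- apply (Rmult_le_reg_r (Re z)); [easy|].
  unfold Rdiv; rewrite Rmult_assoc, Rinv_l; lra.
Qed.

(** * The main part of the expansion and its derivative *)

(** A primitive of [1/2 log(z / 2 pi) + (7/4) / z] in the right half-plane. *)
Definition main_part (z : C) : C :=
  (z / 2 * Clog (z / (2 * PI)%R) - z / 2 + 7 / 4 * Clog z)%C.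

(** Coefficients of the termwise primitive: [a_{n+1} / z^(n+1)] integrates to [- a_{n+1} / (n z^n)].
    At index 0 [from1] gives 0, which hides the division by [INR 0]. *)
Definition integrated (a : nat -> R) : nat -> C :=
  from1 (fun n => - (a (n + 1)%nat / INR n)).

Definition tail_sum (b : nat -> C) (N : nat) (z : C) : C :=
  sum_n (fun n => b n / z ^ n)%C N.

Lemma tail_sum_S (b : nat -> C) (N : nat) (z : C) :
  tail_sum b (S N) z = (tail_sum b N z + b (S N) / z ^ S N)%C.
Proof. unfold tail_sum; now rewrite sum_Sn. Qed.

Lemma tail_sum_0 (c : nat -> R) (z : C) : tail_sum (from1 c) 0 z = RtoC 0.
Proof. unfold tail_sum; rewrite sum_O; simpl; unfold Cdiv; ring. Qed.

Lemma cder_pow_S (p q : C) (t : R) (n : nat) :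
  cder (fun s => ((p + s * q) ^ S n)%C) t (INR (S n) * q * (p + t * q) ^ n)%C.
Proof.
induction n as [|n IH].
- replace (INR 1 * q * (p + t * q) ^ 0)%C with q by (simpl; ring).
  apply (cder_ext (fun s => (p + s * q)%C)); [|apply cder_affine].
  intros s; now rewrite Cpow_1_r.
- apply (cder_ext (fun s => ((p + s * q) * (p + s * q) ^ S n)%C)).
  { intros s; now rewrite <- Cpow_S. }
  replace (INR (S (S n)) * q * (p + t * q) ^ S n)%C
    with (q * (p + t * q) ^ S n + (p + t * q) * (INR (S n) * q * (p + t * q) ^ n))%C.
  + apply (cder_mult (fun s => (p + s * q)%C)); [apply cder_affine | easy].
  + rewrite (S_INR (S n)), RtoC_plus, Cpow_S; ring.
Qed.

(** Differentiation raises the order from [N] to [N + 1] and reproduces every term except [a_1 / z],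
    which is left to the logarithm in [main_part]. *)
Lemma cder_tail_sum (a : nat -> R) (p q : C) (t : R) (N : nat) :
  (p + t * q)%C <> RtoC 0 ->
  cder (fun s => tail_sum (integrated a) N (p + s * q)) t
    (q * (tail_sum (from1 a) (S N) (p + t * q) - a 1%nat / (p + t * q)))%C.
Proof.
intros Hz; induction N as [|N IH].
- apply (cder_ext (fun _ => RtoC 0)).
  { intros s; symmetry; apply tail_sum_0. }
  replace (q * _)%C with (RtoC 0); [apply cder_const|].
  rewrite tail_sum_S, tail_sum_0, Cpow_1_r; simpl; ring.
- apply (cder_ext (fun s => (tail_sum (integrated a) N (p + s * q)
           + integrated a (S N) * / (p + s * q) ^ S N)%C)).
  { intros s; now rewrite tail_sum_S. }
  rewrite tail_sum_S; set (z := (p + t * q)%C) in *.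
  replace (q * (tail_sum (from1 a) (S N) z + from1 a (S (S N)) / z ^ S (S N)
             - a 1%nat / z))%C
    with (q * (tail_sum (from1 a) (S N) z - a 1%nat / z)
      + integrated a (S N) *
         (- (INR (S N) * q * z ^ N) * / z ^ S N * / z ^ S N))%C.
  + apply cder_plus; [easy|].
    apply cder_scal, cder_inv; [now apply Cpow_nz | apply cder_pow_S].
  + change (integrated a (S N)) with (RtoC (- (a (S N + 1)%nat / INR (S N)))).
    change (from1 a (S (S N))) with (RtoC (a (S (S N)))).
    rewrite RtoC_opp, RtoC_div by (apply not_0_INR; lia).
    rewrite Nat.add_1_r, !Cpow_S.
    assert (RtoC (INR (S N)) <> RtoC 0).
    { intros E; apply RtoC_inj in E; revert E; apply not_0_INR; lia. }
    assert (Hp := Cpow_nz z N Hz).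
    field; repeat split; easy.
Qed.

Lemma cder_main_part (p q : C) (t : R) :
  0 < Re (p + t * q)%C ->
  cder (fun s => main_part (p + s * q)) t
    (q * (/ 2 * Clog ((p + t * q) / (2 * PI)%R) + 7 / 4 / (p + t * q)))%C.
Proof.
intros Hz; unfold main_part.
assert (Hpi := PI_RGT_0).
set (z := (p + t * q)%C) in *.
assert (Hz0 : z <> RtoC 0) by (intros E; rewrite E in Hz; simpl in Hz; lra).
assert (Hc : RtoC (2 * PI) <> RtoC 0) by (intros E; apply RtoC_inj in E; lra).
assert (D := cder_affine p q t).
assert (Dh : forall c : C, cder (fun s => ((p + s * q) / c)%C) t (q / c)%C).
{ intros c; apply (cder_ext (fun s => (/ c * (p + s * q))%C)).
  - intros s; unfold Cdiv; ring.
  - replace (q / c)%C with (/ c * q)%C by (unfold Cdiv; ring).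
    now apply cder_scal. }
assert (D1 : cder (fun s => Clog ((p + s * q) / (2 * PI)%R)) t (q / z)%C).
{ replace (q / z)%C with (q / (2 * PI)%R / (z / (2 * PI)%R))%C
    by (field; split; easy).
  apply (cder_log (fun s => ((p + s * q) / (2 * PI)%R)%C)); [|apply Dh].
  fold z.
  replace (Re (z / (2 * PI)%R)) with (Re z / (2 * PI)).
  - apply Rdiv_lt_0_compat; lra.
  - destruct z as [x y]; simpl; field; lra. }
assert (D2 : cder (fun s => Clog (p + s * q)) t (q / z)%C).
{ now apply cder_log. }
replace (q * _)%C with
  ((q / 2 * Clog (z / (2 * PI)%R) + z / 2 * (q / z)) - q / 2 + 7 / 4 * (q / z))%C
  by (field; easy).
apply cder_plus; [apply cder_minus|].
- apply (cder_mult (fun s => ((p + s * q) / 2)%C)); auto.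
- apply Dh.
- now apply cder_scal.
Qed.

(** Expansions of different orders thus differ by [O(1/|z|)], which gives all remainders the same
    limit constant. *)
Lemma tail_sum_bound (c : nat -> R) (N : nat) :
  exists K, 0 <= K /\ forall z, 1 <= Cmod z ->
    Cmod (tail_sum (from1 c) N z) <= K / Cmod z.
Proof.
induction N as [|N [K [HK IH]]].
- exists 0; split; [lra|]; intros z Hz.
  rewrite tail_sum_0, Cmod_0; unfold Rdiv; lra.
- exists (K + Rabs (c (S N))); split; [generalize (Rabs_pos (c (S N))); lra|].
  intros z Hz; rewrite tail_sum_S.
  assert (Hz0 : z <> RtoC 0) by (apply Cmod_gt_0; lra).
  eapply Rle_trans; [apply Cmod_triangle|].
  unfold Rdiv; rewrite Rmult_plus_distr_r; apply Rplus_le_compat; [now apply IH|].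
  rewrite Cmod_div by now apply Cpow_nz.
  simpl from1; rewrite Cmod_R, Cmod_pow.
  apply Rmult_le_compat_l; [apply Rabs_pos|].
  apply Rinv_le_contravar; [lra|].
  simpl; generalize (pow_R1_Rle _ N Hz); nra.
Qed.

(** * Integration of the expansion *)

(* [h N] is the difference between the integrated function and its expansion
   to order [N], and [r N] is its derivative.  Integrating from [x] to
   infinity fixes the constant; the rest of the sector is reached from the
   real axis by vertical segments. *)
Lemma integrate_expansion (h r : nat -> C -> C) (c : nat -> R) (A : R) :
  (forall N z, h N z = h O z - tail_sum (from1 c) N z)%C ->
  (forall N x y phi dphi, A < x <= y ->
     (forall t, x <= t <= y -> is_derive phi t (dphi t)) ->
     (forall t, x <= t <= y -> Cmod (r N (RtoC t)) <= dphi t) ->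
     Cmod (h N (RtoC y) - h N (RtoC x)) <= 2 * (phi y - phi x)) ->
  (forall N x y k, A < x ->
     (forall t, 0 <= t <= 1 -> Cmod (r N (x, t * y)) <= k) ->
     Cmod (h N (x, y) - h N (RtoC x)) <= 2 * (Rabs y * k)) ->
  (forall N eps eta, 0 < eps < PI / 2 -> 0 < eta -> exists X, forall z,
     X < Cmod z -> sector eps z -> Cmod (r N z) * Cmod z ^ S N < eta) ->
  (forall x, A < x -> Im (h O (RtoC x)) = 0) ->
  exists B : R, forall N eps eta, 0 < eps < PI / 2 -> 0 < eta ->
    exists X, forall z, X < Cmod z -> sector eps z ->
      Cmod (h N z - B) * Cmod z ^ N < eta.
Proof.
intros Hh Hreal Hvert Hr Him.
assert (Hpi := PI_RGT_0).
assert (sec_R : forall eps x, 0 < eps < PI / 2 -> 0 < x -> sector eps (RtoC x)).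
{ intros eps x He Hx; apply sector_intro; auto; simpl; rewrite Rabs_R0.
  apply Rmult_le_pos; [|lra]; left; apply tan_gt_0; lra. }
(* Cauchy estimate on the real axis. For [N > 0] the bound [eta / t^(N+1)] has the primitive
   [-(eta/N) t^(-N)], which tends to 0 at infinity. *)
assert (step : forall N eta, (0 < N)%nat -> 0 < eta -> exists X, forall x y,
  X < x <= y -> Cmod (h N (RtoC y) - h N (RtoC x)) <= 2 * eta / x ^ N).
{ intros N eta HN Heta.
  (* Any opening would do: the positive axis lies in every sector. *)
  destruct (Hr N (PI / 4) eta ltac:(lra) Heta) as [X HX].
  exists (Rmax 0 (Rmax A X)); intros x y [Hx Hxy].
  assert (X1 := Rmax_l 0 (Rmax A X)); assert (X2 := Rmax_r 0 (Rmax A X)).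
  assert (X3 := Rmax_l A X); assert (X4 := Rmax_r A X).
  assert (HN1 : 1 <= INR N) by (apply (le_INR 1); lia).
  assert (Hpow : forall t n, x <= t -> 0 < t ^ n) by (intros; apply pow_lt; lra).
  eapply Rle_trans.
  - apply (Hreal N x y (fun t => - (eta / INR N) * / t ^ N)
             (fun t => eta / t ^ S N)); [lra| |].
    + intros t Ht; destruct N as [|n]; [lia|].
      assert (h1 := Hpow t n ltac:(lra)).
      auto_derive.
      * apply Rgt_not_eq, (Hpow t (S n)); lra.
      * change (match n with 0%nat => 1 | S _ => INR n + 1 end) with (INR (S n)).
        rewrite <- !tech_pow_Rmult; field; repeat split; lra.
    + intros t Ht.
      apply (Rmult_le_reg_r (t ^ S N)); [apply Hpow; lra|].
      unfold Rdiv; rewrite Rmult_assoc, Rinv_l, Rmult_1_r.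
      2: apply Rgt_not_eq, Hpow; lra.
      assert (E : Cmod (RtoC t) = t) by (rewrite Cmod_R; apply Rabs_pos_eq; lra).
      rewrite <- E at 2; left; apply HX; [rewrite E; lra|].
      apply sec_R; lra.
  - assert (h1 : 0 < / x ^ N) by (apply Rinv_0_lt_compat, Hpow; lra).
    assert (h2 : 0 < / y ^ N) by (apply Rinv_0_lt_compat, Hpow; lra).
    assert (h3 : eta / INR N <= eta).
    { apply (Rmult_le_reg_r (INR N)); [lra|].
      unfold Rdiv; rewrite Rmult_assoc, Rinv_l; nra. }
    assert (h4 : 0 < eta / INR N) by (apply Rdiv_lt_0_compat; lra).
    unfold Rdiv at 3; nra. }
assert (Hdiff : forall N, exists K, 0 <= K /\ forall z, 1 <= Cmod z ->
  Cmod (h N z - h 1%nat z) <= K / Cmod z).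
{ intros N.
  destruct (tail_sum_bound c N) as [K1 [p1 H1]].
  destruct (tail_sum_bound c 1) as [K2 [p2 H2]].
  exists (K1 + K2); split; [lra|]; intros z Hz.
  rewrite (Hh N), (Hh 1%nat).
  replace (h 0%nat z - tail_sum (from1 c) N z - (h 0%nat z - tail_sum (from1 c) 1 z))%C
    with (- tail_sum (from1 c) N z + tail_sum (from1 c) 1 z)%C by ring.
  eapply Rle_trans; [apply Cmod_triangle|]; rewrite Cmod_opp.
  generalize (H1 z Hz) (H2 z Hz); unfold Rdiv; lra. }
assert (Hlim : exists B : R, is_lim_seq (fun n => Re (h 1%nat (RtoC (INR n)))) B).
{ apply ex_lim_seq_cauchy_corr; intros e.
  (* At order 1 the increments beyond [n >= 1] are at most [2 (e/4) / n <= e/2]. *)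
  assert (He : 0 < e / 4) by (generalize (cond_pos e); lra).
  destruct (step 1%nat (e / 4) ltac:(lia) He) as [X HX].
  destruct (nfloor_ex (Rmax 1 X)) as [N0 [_ HN0]].
  { generalize (Rmax_l 1 X); lra. }
  exists (S N0).
  assert (W : forall n m, (S N0 <= n)%nat -> (n <= m)%nat ->
    Rabs (Re (h 1%nat (RtoC (INR m))) - Re (h 1%nat (RtoC (INR n)))) < e).
  { intros n m Hn Hm.
    assert (h1 : INR (S N0) <= INR n) by now apply le_INR.
    assert (h2 : INR n <= INR m) by now apply le_INR.
    rewrite S_INR in h1.
    assert (X1 := Rmax_l 1 X); assert (X2 := Rmax_r 1 X).
    assert (h3 := HX (INR n) (INR m) ltac:(lra)).
    apply (Rle_lt_trans _ _ _ (re_le_Cmod (h 1%nat (RtoC (INR m)) - h 1%nat (RtoC (INR n))))).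
    eapply Rle_lt_trans; [exact h3|].
    assert (/ INR n <= 1).
    { rewrite <- Rinv_1; apply Rinv_le_contravar; lra. }
    rewrite pow_1; unfold Rdiv at 1.
    generalize (cond_pos e); nra. }
  intros n m Hn Hm; destruct (Nat.le_ge_cases n m).
  - rewrite Rabs_minus_sym; now apply W.
  - now apply W. }
destruct Hlim as [B HB]; exists B.
assert (close : forall N delta Y, 0 < delta -> exists y,
  Y <= y /\ Cmod (h N (RtoC y) - B) < delta).
{ intros N delta Y Hd.
  destruct (Hdiff N) as [K [HK HD]].
  assert (Hd2 : 0 < delta / 2) by lra.
  destruct (proj2 (is_lim_seq_spec _ _) HB (mkposreal _ Hd2)) as [n0 Hn0].
  (* The four entries secure [|z| >= 1], the domain beyond [A], the requested [Y], and
     [K / n < delta / 2]. *)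
  set (Z := Rmax (Rmax 1 (A + 1)) (Rmax Y (2 * K / delta + 1))).
  assert (Z1 : 1 <= Z).
  { eapply Rle_trans; [|apply Rmax_l]; apply Rmax_l. }
  assert (Z2 : A + 1 <= Z).
  { eapply Rle_trans; [|apply Rmax_l]; apply Rmax_r. }
  assert (Z3 : Y <= Z).
  { eapply Rle_trans; [|apply Rmax_r]; apply Rmax_l. }
  assert (Z4 : 2 * K / delta + 1 <= Z).
  { eapply Rle_trans; [|apply Rmax_r]; apply Rmax_r. }
  destruct (nfloor_ex Z) as [m [_ Hm]]; [lra|].
  set (n := (n0 + S m)%nat).
  assert (Hn : Z < INR n).
  { unfold n; rewrite plus_INR, S_INR; generalize (pos_INR n0); lra. }
  exists (INR n); split; [lra|].
  assert (E : Cmod (RtoC (INR n)) = INR n) by (rewrite Cmod_R; apply Rabs_pos_eq; lra).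
  replace (h N (RtoC (INR n)) - B)%C
    with ((h N (RtoC (INR n)) - h 1%nat (RtoC (INR n)))
          + (h 1%nat (RtoC (INR n)) - B))%C by ring.
  eapply Rle_lt_trans; [apply Cmod_triangle|].
  assert (P1 : Cmod (h N (RtoC (INR n)) - h 1%nat (RtoC (INR n))) < delta / 2).
  { eapply Rle_lt_trans; [apply HD; rewrite E; lra|]; rewrite E.
    apply (Rmult_lt_reg_r (INR n)); [lra|].
    unfold Rdiv at 1; rewrite Rmult_assoc, Rinv_l by lra.
    apply Rlt_le_trans with (delta / 2 * (2 * K / delta + 1)).
    - replace (delta / 2 * (2 * K / delta + 1)) with (K + delta / 2) by (field; lra).
      lra.
    - apply Rmult_le_compat_l; lra. }
  assert (P2 : Cmod (h 1%nat (RtoC (INR n)) - B) < delta / 2).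
  { specialize (Hn0 n ltac:(unfold n; lia)); simpl in Hn0.
    eapply Rle_lt_trans; [apply Cmod_le_re_im|].
    (* [B] was defined as a limit of real parts only. On the axis the imaginary part of [h 0]
       vanishes by hypothesis, and the coefficients are real, so [B] is the limit of [h 1]
       itself. *)
    assert (I : Im (h 1%nat (RtoC (INR n)) - B)%C = 0).
    { assert (I0 : Im (h 1%nat (RtoC (INR n))) = 0).
      { rewrite Hh, tail_sum_S, tail_sum_0, Cpow_1_r.
        assert (I1 := Him (INR n) ltac:(lra)).
        unfold Im in *; simpl; rewrite I1; field; lra. }
      unfold Im in *; simpl; rewrite I0; ring. }
    rewrite I, Rabs_R0, Rplus_0_r; exact Hn0. }
  lra. }
assert (main : forall N eps eta, (0 < N)%nat -> 0 < eps < PI / 2 -> 0 < eta ->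
  exists X, forall z, X < Cmod z -> sector eps z ->
  Cmod (h N z - B) * Cmod z ^ N < eta).
{ intros N eps eta HN He Heta.
  set (T := tan (PI / 2 - eps)).
  assert (HT : 0 < T) by (apply tan_gt_0; lra).
  (* One factor [1 + T] comes from the two legs of the path, the other [N] from
     [|z| <= (1 + T) Re z]. The total is [2 e Q = 2 eta / 3 < eta]. *)
  set (Q := (1 + T) ^ S N).
  assert (HQ : 0 < Q) by (apply pow_lt; lra).
  set (e := eta / (3 * Q)).
  assert (He' : 0 < e) by (apply Rdiv_lt_0_compat; lra).
  destruct (step N e HN He') as [X1 HX1].
  destruct (Hr N eps e He He') as [X2 HX2].
  set (X := Rmax (Rmax 0 A) (Rmax X1 X2)).
  assert (x0 : 0 <= X).
  { eapply Rle_trans; [|apply Rmax_l]; apply Rmax_l. }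
  assert (xA : A <= X).
  { eapply Rle_trans; [|apply Rmax_l]; apply Rmax_r. }
  assert (x1 : X1 <= X).
  { eapply Rle_trans; [|apply Rmax_r]; apply Rmax_l. }
  assert (x2 : X2 <= X).
  { eapply Rle_trans; [|apply Rmax_r]; apply Rmax_r. }
  exists ((1 + T) * X); intros z Hz Hs.
  assert (Hz0 : 0 < Cmod z) by nra.
  destruct (sector_pos eps z He Hz0 Hs) as [Hx Hy]; fold T in Hy.
  assert (Hmod : Cmod z <= (1 + T) * Re z).
  { eapply Rle_trans; [apply Cmod_le_re_im|].
    rewrite (Rabs_pos_eq (Re z)); lra. }
  destruct z as [x y]; simpl in Hx, Hy, Hmod.
  assert (HxX : X < x) by nra.
  assert (Hpx : 0 < x ^ N) by (apply pow_lt; lra).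
  (* The Cauchy estimate from [x] to a far point [y'] where [h N] is within [delta] of [B]; [delta]
     is arbitrary. *)
  assert (R1 : Cmod (h N (RtoC x) - B) <= 2 * e / x ^ N).
  { apply Rle_plus_epsilon; intros delta Hdelta.
    destruct (close N delta x Hdelta) as [y' [Hy' Hc]].
    replace (h N (RtoC x) - B)%C
      with (- (h N (RtoC y') - h N (RtoC x)) + (h N (RtoC y') - B))%C by ring.
    eapply Rle_trans; [apply Cmod_triangle|]; rewrite Cmod_opp.
    generalize (HX1 x y' ltac:(lra)); lra. }
  (* The vertical segment stays in the sector, and its points have modulus at least [x], so the
     remainder there is at most [e / x^(N+1)]. *)
  assert (R2 : Cmod (h N (x, y) - h N (RtoC x)) <= 2 * (Rabs y * (e / x ^ S N))).
  { apply Hvert; [lra|]; intros t Ht.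
    assert (Hxw : x <= Cmod (x, t * y)).
    { eapply Rle_trans; [|apply re_le_Cmod]; simpl; apply Rle_abs. }
    assert (Hw : Cmod (r N (x, t * y)) * Cmod (x, t * y) ^ S N < e).
    { apply HX2; [lra|]; apply sector_intro; auto; simpl; fold T.
      rewrite Rabs_mult, (Rabs_pos_eq t) by lra.
      generalize (Rabs_pos y); nra. }
    apply (Rmult_le_reg_r (x ^ S N)); [apply pow_lt; lra|].
    unfold Rdiv; rewrite Rmult_assoc, Rinv_l, Rmult_1_r.
    2: apply Rgt_not_eq, pow_lt; lra.
    eapply Rle_trans; [|left; exact Hw].
    apply Rmult_le_compat_l; [apply Cmod_ge_0|].
    apply pow_incr; lra. }
  assert (R3 : Rabs y * (e / x ^ S N) <= T * (e / x ^ N)).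
  { replace (T * (e / x ^ N)) with (T * x * (e / x ^ S N)).
    - apply Rmult_le_compat_r; [|easy].
      left; apply Rdiv_lt_0_compat; [easy | apply pow_lt; lra].
    - simpl; field; lra. }
  assert (R4 : Cmod (h N (x, y) - B) <= 2 * (1 + T) * e / x ^ N).
  { replace (h N (x, y) - B)%C
      with ((h N (x, y) - h N (RtoC x)) + (h N (RtoC x) - B))%C by ring.
    eapply Rle_trans; [apply Cmod_triangle|].
    unfold Rdiv in *; lra. }
  apply Rle_lt_trans with (2 * (1 + T) * e / x ^ N * ((1 + T) * x) ^ N).
  - apply Rmult_le_compat; [apply Cmod_ge_0 | apply pow_le; lra | easy |].
    apply pow_incr; lra.
  - rewrite Rpow_mult_distr.
    replace (2 * (1 + T) * e / x ^ N * ((1 + T) ^ N * x ^ N))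
      with (2 * e * Q) by (unfold Q; simpl; field; lra).
    unfold e; replace (2 * (eta / (3 * Q)) * Q) with (2 * eta / 3) by (field; lra).
    lra. }
(* For [N = 0]: [h 1] tends to [B] and [h 0 - h 1] is [O(1/|z|)]. *)
intros [|N] eps eta He Heta; [|apply main; auto; lia].
destruct (main 1%nat eps (eta / 2) ltac:(lia) He ltac:(lra)) as [X HX].
destruct (Hdiff 0%nat) as [K [HK HD]].
set (Y := Rmax (Rmax 1 X) (2 * K / eta)).
assert (Y1 : 1 <= Y).
{ eapply Rle_trans; [|apply Rmax_l]; apply Rmax_l. }
assert (Y2 : X <= Y).
{ eapply Rle_trans; [|apply Rmax_l]; apply Rmax_r. }
assert (Y3 : 2 * K / eta <= Y) by apply Rmax_r.
exists Y; intros z Hz Hs; rewrite pow_O, Rmult_1_r.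
replace (h 0%nat z - B)%C with ((h 0%nat z - h 1%nat z) + (h 1%nat z - B))%C by ring.
eapply Rle_lt_trans; [apply Cmod_triangle|].
assert (P1 : Cmod (h 0%nat z - h 1%nat z) <= eta / 2).
{ eapply Rle_trans; [apply HD; lra|].
  apply (Rmult_le_reg_r (Cmod z)); [lra|].
  unfold Rdiv at 1; rewrite Rmult_assoc, Rinv_l by lra.
  apply Rle_trans with (eta / 2 * (2 * K / eta)).
  - right; field; lra.
  - apply Rmult_le_compat_l; lra. }
assert (P2 : Cmod (h 1%nat z - B) < eta / 2).
{ eapply Rle_lt_trans; [|apply (HX z ltac:(lra) Hs)].
  rewrite pow_1; generalize (Cmod_ge_0 (h 1%nat z - B)); nra. }
lra.
Qed.

(** * The logarithmic series of a Riemann sequence *)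

(** The generating function at [t = 0] gives [E_0 = 1], whence [(8 - 1) / 4]. *)
Lemma stirling_coef_1 (E Bn : nat -> R) :
  euler_numbers E -> stirling_coef E Bn 1 = 7 / 4.
Proof.
intros H; apply locally_singleton, is_pseries_unique in H.
rewrite PSeries_0, Rmult_0_r, exp_0 in H; simpl in H.
unfold stirling_coef; simpl; lra.
Qed.

(** One form for both kinds of segment: [p = 0], [q = 1] on the real axis, and [p = x], [q = iy] on
    vertical segments. *)
Lemma log_series_mean_value (alpha : nat -> C) (M : R) (L : nat -> C -> C)
    (S F : C -> C) (a : nat -> R) (N : nat) (c : nat -> R)
    (p q : C) (phi dphi : R -> R) (x y : R) :
  x <= y -> ex_series c -> a 1%nat = 7 / 4 ->
  (forall n, wedge (alpha n)) ->
  (forall n, is_log_branch (log_region M)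
     (fun z => (1 + z ^ 2 / alpha n ^ 2)%C) (L n)) ->
  (forall s : R, log_region M (p + s * q)%C) ->
  (forall t, x <= t <= y -> 0 < Re (p + t * q)%C) ->
  (forall k t, x <= t <= y ->
     Cmod (q * (2 * (p + t * q) / ((p + t * q) ^ 2 + alpha k ^ 2))) <= c k) ->
  (forall t, x <= t <= y -> is_series (K := C_AbsRing) (V := C_NormedModule)
     (fun n => L n (p + t * q)%C) (S (p + t * q)%C)) ->
  (forall t, x <= t <= y -> is_series (K := C_AbsRing) (V := C_NormedModule)
     (fun k => (2 * (p + t * q) / ((p + t * q) ^ 2 + alpha k ^ 2))%C)
     (F (p + t * q)%C)) ->
  (forall t, x <= t <= y -> is_derive phi t (dphi t)) ->
  (forall t, x <= t <= y ->
     Cmod (q * (F (p + t * q)%C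
       - / 2 * Clog ((p + t * q) / (2 * PI)%R)
       - tail_sum (from1 a) (Datatypes.S N) (p + t * q))) <= dphi t) ->
  let h := fun z => (S z - main_part z - tail_sum (integrated a) N z)%C in
  Cmod (h (p + y * q)%C - h (p + x * q)%C)%C <= 2 * (phi y - phi x).
Proof.
intros Hxy Hc Ha Hw HL Hreg Hpos Hb HS HF Hphi Hle h; unfold h.
set (g := fun s : R => (main_part (p + s * q) + tail_sum (integrated a) N (p + s * q))%C).
replace (S (p + y * q)%C - main_part (p + y * q) - tail_sum (integrated a) N (p + y * q)
  - (S (p + x * q)%C - main_part (p + x * q) - tail_sum (integrated a) N (p + x * q)))%C
  with ((S (p + y * q)%C - g y) - (S (p + x * q)%C - g x))%C by (unfold g; ring).
apply (cseries_mean_value (fun k s => L k (p + s * q)%C)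
  (fun k t => (q * (2 * (p + t * q) / ((p + t * q) ^ 2 + alpha k ^ 2)))%C) c
  (fun t => (q * F (p + t * q)%C)%C) g
  (fun t => (q * (/ 2 * Clog ((p + t * q) / (2 * PI)%R)
       + tail_sum (from1 a) (Datatypes.S N) (p + t * q)))%C) phi dphi); auto.
- intros k t _; apply (log_branch_path (log_region M)); auto using wedge_neq_0.
- intros t Ht.
  apply (is_series_scal (K := C_AbsRing) (V := C_NormedModule) q), HF, Ht.
- intros t Ht.
  assert (Hz : (p + t * q)%C <> RtoC 0).
  { intros E; specialize (Hpos t Ht); rewrite E in Hpos; simpl in Hpos; lra. }
  match goal with |- cder _ _ ?l => replace l with
    (q * (/ 2 * Clog ((p + t * q) / (2 * PI)%R) + 7 / 4 / (p + t * q))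
     + q * (tail_sum (from1 a) (Datatypes.S N) (p + t * q) - a 1%nat / (p + t * q)))%C
  end.
  + apply cder_plus; [apply cder_main_part; auto | now apply cder_tail_sum].
  (* The [(7/4) / z] from [main_part] cancels the [a_1 / z] that is subtracted in the derivative of
     the power part. *)
  + rewrite Ha, RtoC_div by lra; ring.
- intros t Ht; eapply Rle_trans; [|apply (Hle t Ht)].
  right; f_equal; ring.
- apply HS; lra.
- apply HS; lra.
Qed.

Lemma Im_Clog_pos (x : R) : 0 < x -> Im (Clog x) = 0.
Proof.
intros Hx; change (Carg x = 0); rewrite Carg_pos by easy; simpl.
unfold Rdiv; now rewrite Rmult_0_l, atan_0.
Qed.

Lemma Im_main_part (x : R) : 0 < x -> Im (main_part x) = 0.
Proof.
intros Hx; unfold main_part.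
assert (Hpi := PI_RGT_0).
rewrite <- !RtoC_div by lra.
assert (H1 := Im_Clog_pos (x / (2 * PI))); assert (H2 := Im_Clog_pos x Hx).
assert (H3 : 0 < x / (2 * PI)) by (apply Rdiv_lt_0_compat; lra).
specialize (H1 H3).
destruct (Clog (x / (2 * PI))%R) as [u v], (Clog x) as [u' v'].
unfold Im in *; simpl in *; rewrite H1, H2; ring.
Qed.

Theorem theorem18 :
  forall (E Bn : nat -> R) (alpha : nat -> C),
    euler_numbers E ->
    bernoulli_numbers Bn ->
    riemann_sequence E Bn alpha ->
    forall (M : R) (L : nat -> C -> C),
      0 < M ->
      (forall n : nat, Rabs (Im (alpha n)) < M) ->
      (forall n : nat,
         is_log_branch (log_region M)
           (fun z : C => (1 + z ^ 2 / alpha n ^ 2)%C) (L n)) ->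
      exists B : R,
        series_asymp M L
          (fun z : C =>
             (z / 2 * Clog (z / (2 * PI)%R) - z / 2
              + 7 / 4 * Clog z + B)%C)
          (from1 (fun n : nat => - (stirling_coef E Bn (n + 1) / INR n))).
Proof.
intros E Bn alpha HE _ HR M L HM HI HL.
assert (Hw : forall n, wedge (alpha n)) by (intros n; exact (riemann_wedge _ _ _ n HR)).
assert (Ha := stirling_coef_1 E Bn HE).
set (a := stirling_coef E Bn) in *.
destruct (rs_asymp _ _ _ HR) as [a0 [F [HF HFas]]].
assert (Hs := inv_sq_summable alpha F a0 M HM Hw HI HF).
set (S := fun z => CSeries (fun n => L n z)).
assert (HS : forall z, M < Re z -> is_series (K := C_AbsRing) (V := C_NormedModule)
               (fun n => L n z) (S z)).
{ intros z Hz; now apply (log_series_converges alpha M). }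
(* The estimates are made beyond both [M], where the branches live, and [a0], where the series in
   (e) converges. Convergence of the logarithms is already known on all of [M < Re z]. *)
set (A := Rmax M a0).
assert (A1 : M <= A) by apply Rmax_l.
assert (A2 : a0 <= A) by apply Rmax_r.
set (h := fun N z => (S z - main_part z - tail_sum (integrated a) N z)%C).
(* Order [N + 1] here, so that condition (e) at that order gives [r N z * z^(N+1) -> 0]. *)
set (r := fun N z => (F z - / 2 * Clog (z / (2 * PI)%R)
                       - tail_sum (from1 a) (Datatypes.S N) z)%C).
destruct (integrate_expansion h r (fun n => - (a (n + 1)%nat / INR n)) A)
  as [B HB].
- intros N z; unfold h, integrated; rewrite tail_sum_0; ring.
- intros N x y phi dphi Hxy Hphi Hle.
  assert (e : forall t : R, (0 + t * 1)%C = RtoC t) by (intros; ring).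
  rewrite <- (e x), <- (e y).
  apply (log_series_mean_value alpha M L S F a N
    (fun k => 2 * y * / Re (alpha k) ^ 2) 0 1 phi dphi x y);
    auto using region_real; try lra.
  + now apply (ex_series_scal (V := R_NormedModule)).
  + intros t Ht; rewrite e; simpl; lra.
  + intros k t Ht; rewrite e, Cmult_1_l.
    eapply Rle_trans; [apply quotient_bound_real; auto; lra|].
    apply Rmult_le_compat_r; [|lra].
    left; apply Rinv_0_lt_compat, pow_lt; destruct (Hw k); lra.
  + intros t Ht; rewrite e; apply HS; simpl; lra.
  + intros t Ht; rewrite e; apply HF; simpl; lra.
  + intros t Ht; rewrite e, Cmult_1_l; apply Hle; lra.
- intros N x y k Hx Hle.
  assert (e : forall t : R, (x + t * (Ci * y))%C = (x, t * y)).
  { intros t; apply injective_projections; simpl; ring. }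
  assert (e0 : (x, 0 * y) = RtoC x) by (unfold RtoC; f_equal; ring).
  assert (e1 : (x, 1 * y) = (x, y)) by (f_equal; ring).
  rewrite <- e0, <- e1, <- (e 0), <- (e 1).
  replace (2 * (Rabs y * k)) with (2 * (Rabs y * k * 1 - Rabs y * k * 0)) by ring.
  apply (log_series_mean_value alpha M L S F a N
    (fun j => Rabs y * (2 * (x + Rabs y) * ((x - M + Rabs y) / (x - M)) ^ 2)
              * / Re (alpha j) ^ 2) x (Ci * y)
    (fun t => Rabs y * k * t) (fun _ => Rabs y * k) 0 1); auto; try lra.
  + now apply (ex_series_scal (V := R_NormedModule)).
  + intros s; apply region_vertical; lra.
  + intros t Ht; rewrite e; simpl; lra.
  + intros j t Ht; apply vertical_bound; auto; try lra.
    generalize (HI j); lra.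
  + intros t Ht; rewrite e; apply HS; simpl; lra.
  + intros t Ht; rewrite e; apply HF; simpl; lra.
  + intros t Ht; auto_derive; [easy | ring].
  + intros t Ht; rewrite e, !Cmod_mult, Cmod_Ci, Cmod_R, Rmult_1_l.
    apply Rmult_le_compat_l; [apply Rabs_pos|]; apply (Hle t Ht).
- intros N eps eta He Heta.
  destruct (proj1 (filterlim_sector _ _) (HFas (Datatypes.S N) eps He) eta Heta)
    as [X HX].
  exists X; intros z Hz Hsec.
  rewrite <- Cmod_pow, <- Cmod_mult; exact (HX z Hz Hsec).
- intros x Hx; unfold h, integrated; rewrite tail_sum_0.
  assert (H1 : Im (S (RtoC x)) = 0).
  { apply (Im_log_series alpha M L x (S (RtoC x)) Hw (rs_mono _ _ _ HR)
             (rs_mult _ _ _ HR) (rs_conj _ _ _ HR) Hs HL); [lra|].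
    apply HS; simpl; lra. }
  assert (H2 := Im_main_part x ltac:(lra)).
  destruct (S (RtoC x)) as [u v], (main_part (RtoC x)) as [u' v'].
  unfold Im in *; simpl in *; rewrite H1, H2; ring.
- exists B, S; split; [exact HS|].
  intros N eps He; apply filterlim_sector; intros eta Heta.
  destruct (HB N eps eta He Heta) as [X HX].
  exists X; intros z Hz Hsec.
  rewrite Cmod_mult, Cmod_pow.
  eapply Rle_lt_trans; [|exact (HX z Hz Hsec)].
  (* [asymp] counts [B] as part of the function subtracted, whereas [h N] is compared with [B]; the
     two differences coincide. *)
  right; f_equal; f_equal; unfold h, main_part, tail_sum, integrated; ring.
Qed.
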